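(* Given a type $\sigma$ and a sequence of blocks $\delta = (d_1^{r_1}, \ldots, d_{s}^{r_s})$, \[ s_\sigma^\otimes E^+_{\delta} = \sum_{\tau} \left[\sum_{T\in\mathrm{TPRT}'(\tau/\sigma,\delta)} \operatorname{sgn}^+(T)\right] s_{\tau}^{\otimes} \quad\text{and}\quad s_\sigma^\otimes E_{\delta} = \sum_{\tau} \left[\sum_{T\in\mathrm{TPRT}'(\tau/\sigma,\delta)} \operatorname{sgn}^-(T)\right] s_{\tau}^{\otimes}, \] where the outer sums are over types $\tau$ and $\mathrm{TPRT}'(\tau/\sigma,\delta)$ is the set of dual tensor polyribbon tableaux of shape $\tau/\sigma$ and content $\delta$.
   Context: An integer partition is a finite (possibly empty) weakly decreasing sequence of positive integers; $\ell(\lambda)$ is its number of parts and $m_k(\lambda)$ the number of parts equal to $k$. A block is an ordered pair of positive integers written $d^m$ (degree $d$, multiplicity $m$). Blocks are ordered by $a^b\ge d^e$ iff $a>d$, or $a=d$ and $b\ge e$. A type is a finite (possibly empty) weakly decreasing sequence of blocks. For $k\ge1$, $\tau|_k$ denotes the integer partition formed by the multiplicities of the blocks of $\tau$ of degree $k$; the type $\tau$ is determined by $(\tau|_k)_{k\ge1}$. Variables: $x_{k,j}$ for $k,j\ge 1$, with $\deg x_{k,j}=k$; $\mathbf{x}_{k*}=(x_{k,1},x_{k,2},\dots)$. The algebra $\mathsf{P\Lambda}$ of polysymmetric functions consists of the formal series over $\mathbb{Q}$ of bounded degree in all the $x_{k,j}$ that, for each fixed $k$, are unchanged by any permutation of the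 variables $\mathbf{x}_{k*}$. Define $s^{\otimes}_\tau=\prod_{k\ge1}s_{\tau|_k}(\mathbf{x}_{k*})$, where $s_\lambda$ is the Schur symmetric function. $E^+_d$ is the sum of all square-free monomials (no variable repeated) of degree $d$ in the variables $x_{k,j}$ (with $\deg x_{k,j}=k$); $E_d$ is the sum of the same monomials, each multiplied by $(-1)^q$ where $q$ is the number of variables in the monomial. $E^+_{d^r}$ and $E_{d^r}$ are obtained from $E^+_d$ and $E_d$ by replacing every variable $x_{k,j}$ by $x_{k,j}^r$. For an ordered sequence of blocks $\delta=(d_1^{r_1},\dots,d_s^{r_s})$, $E^+_\delta=\prod_iE^+_{d_i^{r_i}}$ and $E_\delta=\prod_iE_{d_i^{r_i}}$. The diagram $\mathrm{dg}(\mu)$ is the set of boxes $(i,j)$ (row $i$, column $j$) with $1\le i\le\ell(\mu)$, $1\le j\le\mu_i$ (row $1$ at the top, column $1$ at the left). For $\mathrm{dg}(\mu)\subseteq\mathrm{dg}(\nu)$, $\nu/\mu=\mathrm{dg}(\nu)\setminus\mathrm{dg}(\mu)$. It is an $r$-ribbon if it consists of $r$ boxes that can be labeled $b_1,\dots,b_r$ so that for $1<i\le r$, $b_i$ is one unit left of or one unit below $b_{i-1}$. If a ribbon $R$ has boxes in exactly $q$ different rows, $\operatorname{sgn}(R)=(-1)^{q-1}$, and $\mathrm{left}(R)$ is the least index of a column containing a box of $R$. A skew shape $\lambda/\mu$ is a dual $r^n$-polyribbon ($n\ge0$) if there exist partitions $\mu=\gamma_{(0)}\subseteq\gamma_{(1)}\subseteq\cdots\subseteq\gamma_{(n)}=\lambda$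 such that $\gamma_{(i)}/\gamma_{(i-1)}$ is an $r$-ribbon for $1\le i\le n$ and $\mathrm{left}(\gamma_{(i)}/\gamma_{(i-1)})\ge\mathrm{left}(\gamma_{(i+1)}/\gamma_{(i)})$ for $1\le i\le n-1$ (such a list is unique if it exists; for $n=0$ the shape is empty). Its sign is $\operatorname{sgn}'_r(\lambda/\mu)=\prod_{i=1}^n\operatorname{sgn}(\gamma_{(i)}/\gamma_{(i-1)})$. For types $\tau,\sigma$, $\tau/\sigma$ is a dual $d^r$-tensor polyribbon if, for some partition $\lambda$ of $d$ (the associated partition), $(\tau|_k)/(\sigma|_k)$ is a dual $r^{m_k(\lambda)}$-polyribbon for all $k\ge1$. Then $\operatorname{sgn}^+_r(\tau/\sigma)=\prod_{k\ge1}\operatorname{sgn}'_r((\tau|_k)/(\sigma|_k))$ and $\operatorname{sgn}^-_r(\tau/\sigma)=(-1)^{\ell(\lambda)}\prod_{k\ge1}\operatorname{sgn}'_r((\tau|_k)/(\sigma|_k))$. A dual tensor polyribbon tableau $T$ of shape $\tau/\sigma$ and content $\delta$ is a sequence of types $\sigma=\tau_{(0)},\tau_{(1)},\dots,\tau_{(s)}=\tau$ such that, for $1\le i\le s$, $\tau_{(i)}/\tau_{(i-1)}$ is a dual $d_i^{r_i}$-tensor polyribbon. Its signs are $\operatorname{sgn}^{\pm}(T)=\prod_{i=1}^s\operatorname{sgn}^{\pm}_{r_i}(\tau_{(i)}/\tau_{(i-1)})$. *)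

(* Defs.v *)
From HB Require Import structures.
From mathcomp Require Import all_boot all_order all_algebra finmap multiset.
From mathcomp Require Import mathcomp_extra boolp classical_sets functions.
From mathcomp Require Import cardinality fsbigop.

Set Implicit Arguments.
Unset Strict Implicit.
Unset Printing Implicit Defensive.

Import GRing.Theory.

(* The pair (k, j) stands for the variable x_{k+1,j+1}, of degree k+1; a
   monomial is the multiset of its variables. *)
Notation monom := {mset nat * nat}%mset.

Definition mone : monom := mset0.
Definition mmul (a b : monom) : monom := msetD a b.
Definition mdegree (m : monom) : nat := \sum_(v <- m) v.1.+1.
Definition mpow (r : nat) (m : monom) : monom :=
  [fsfun v in finsupp m => r * m v].

Lemma mmulA : associative mmul. Proof. exact: msetDA. Qed.
Lemma mmulC : commutative mmul. Proof. exact: msetDC. Qed.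
Lemma mmul1m : left_id mone mmul. Proof. exact: mset0D. Qed.
Lemma mmulE a b v : mmul a b v = a v + b v. Proof. by rewrite /mmul msetE2. Qed.

Section Divisors.
Local Open Scope classical_set_scope.

Lemma finite_divisors (m : monom) :
  finite_set [set a : monom | forall v, a v <= m v].
Proof.
pose N := (\max_(v <- finsupp m) m v).+1.
pose mk (f : {ffun finsupp m -> 'I_N}) : monom :=
  [fsfun v : finsupp m => (f v : nat)].
apply: (@sub_finite_set _ _ (mk @` setT)); last first.
  by apply: finite_image; exact: finite_finset.
move=> a /= am.
have bnd (v : finsupp m) : a (val v) < N.
  rewrite ltnS; apply: leq_trans (am _) _.
  exact: (leq_bigmax_seq (F := fun v => m v) _ (fsvalP v) isT).
exists [ffun v => Ordinal (bnd v)] => //.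
apply/fsfunP => v; rewrite fsfun_ffun.
case: insubP => [u _ uv|vm] /=; first by rewrite ffunE /= uv.
by have := am v; rewrite (fsfun_dflt vm) leqn0 => /eqP ->.
Qed.

Definition divs (m : monom) := fset_set [set a : monom | forall v, a v <= m v].

Lemma mem_divs (m a : monom) : reflect (forall v, a v <= m v) (a \in divs m).
Proof.
by rewrite /divs in_fset_set; [apply: (iffP idP) => [|h]; rewrite ?inE|
  exact: finite_divisors].
Qed.

Lemma mmul_divs m a b : mmul a b = m -> (a \in divs m) && (b \in divs m).
Proof.
by move=> <-; apply/andP; split; apply/mem_divs => v; rewrite mmulE ?leq_addr ?leq_addl.
Qed.

End Divisors.

Section Series.
Local Open Scope classical_set_scope.
Local Open Scope ring_scope.

(* Formal series in the x_{k,j}, given by their coefficients. *)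
Definition series := monom -> rat.
HB.instance Definition _ := GRing.Lmodule.copy series (monom -> rat^o).

Implicit Types f g h : series.

Definition sone : series := fun m => (m == mone)%:R.
Definition smul f g : series := fun m =>
  \sum_(p \in [set p : monom * monom | mmul p.1 p.2 = m]) f p.1 * g p.2.

Lemma smulE (D : {fset monom}) f g m : (divs m `<=` D)%fset ->
  smul f g m =
  \sum_(a <- D) \sum_(b <- D) (mmul a b == m)%:R * (f a * g b).
Proof.
move=> /fsubsetP mD; rewrite /smul.
rewrite (_ : [set p | _] = [set` [seq p <- [seq (a, b) | a <- D, b <- D]
                           | mmul p.1 p.2 == m]]); last first.
  apply/seteqP; split=> -[a b] /=; rewrite mem_filter; last by case/andP=> /eqP.
  move=> e; rewrite e eqxx /=; have /andP[am bm] := mmul_divs e.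
  by apply/allpairsP; exists (a, b); split=> //; exact: mD.
rewrite -fsbig_seq; last first.
  by apply/filter_uniq/allpairs_uniq => //; [exact: fset_uniq..|move=> [? ?] []].
rewrite big_filter big_mkcond big_allpairs_dep /=.
by apply: eq_bigr => a _; apply: eq_bigr => b _; case: eqP; rewrite ?mul1r ?mul0r.
Qed.

Lemma smulC : commutative smul.
Proof.
move=> f g; apply/funext => m; rewrite !(smulE _ _ (fsubset_refl _)).
rewrite exchange_big; apply: eq_bigr => a _; apply: eq_bigr => b _.
by rewrite mmulC [f _ * _]mulrC.
Qed.

Lemma sum_pick (D : {fset monom}) (x : monom) (F : monom -> rat) :
  (x \notin D -> F x = 0) -> \sum_(a <- D) (x == a)%:R * F a = F x.
Proof.
case: (boolP (x \in D)) => [xD _|xD ->//].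
  rewrite (big_fsetD1 x xD)/= eqxx mul1r big_seq big1 ?addr0// => a.
  by rewrite !inE eq_sym => /andP[/negbTE -> _]; rewrite mul0r.
rewrite big_seq big1// => a aD; case: eqP => [e|]; last by rewrite mul0r.
by rewrite e aD in xD.
Qed.

Lemma smulA : associative smul.
Proof.
move=> f g h; apply/funext => m; set D := divs m.
have Dd a : a \in D -> (divs a `<=` D)%fset.
  move=> /mem_divs am; apply/fsubsetP => b /mem_divs ba.
  by apply/mem_divs => v; exact: leq_trans (ba v) (am v).
have zero x y : x \notin D -> (mmul x y == m)%:R = 0 :> rat.
  move=> xD; case: eqP => // /mmul_divs/andP[xD'].
  by rewrite xD' in xD.
have key f' g' h' : smul (smul f' g') h' m = \sum_(a <- D) \sum_(b <- D)
    \sum_(c <- D) (mmul (mmul a b) c == m)%:R * (f' a * g' b * h' c).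
  rewrite (smulE _ _ (fsubset_refl _)) -/D.
  transitivity (\sum_(e <- D) \sum_(c <- D) \sum_(a <- D) \sum_(b <- D)
     (mmul a b == e)%:R * ((mmul e c == m)%:R * (f' a * g' b * h' c))).
    rewrite big_seq [RHS]big_seq; apply: eq_bigr => e eD; apply: eq_bigr => c _.
    rewrite (smulE _ _ (Dd _ eD)) mulr_suml mulr_sumr; apply: eq_bigr => a _.
    rewrite mulr_suml mulr_sumr; apply: eq_bigr => b _.
    by rewrite !mulrA [_%:R * _%:R]mulrC.
  transitivity (\sum_(a <- D) \sum_(b <- D) \sum_(c <- D) \sum_(e <- D)
     (mmul a b == e)%:R * ((mmul e c == m)%:R * (f' a * g' b * h' c))).
    under eq_bigr do rewrite exchange_big.
    rewrite exchange_big; apply: eq_bigr => a _.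
    under eq_bigr do rewrite exchange_big.
    rewrite exchange_big; apply: eq_bigr => b _.
    by rewrite exchange_big.
  apply: eq_bigr => a _; apply: eq_bigr => b _; apply: eq_bigr => c _.
  rewrite (sum_pick (F := fun e => (mmul e c == m)%:R * _))// => abD.
  by rewrite zero ?mul0r.
rewrite smulC !key.
under eq_bigr do rewrite exchange_big.
rewrite exchange_big; apply: eq_bigr => a _.
apply: eq_bigr => b _; apply: eq_bigr => c _.
by rewrite [mmul _ a]mmulC mmulA [g b * h c * f a]mulrC !mulrA.
Qed.

Lemma smul1s : left_id sone smul.
Proof.
move=> f; apply/funext => m; rewrite (smulE _ _ (fsubset_refl _)).
rewrite exchange_big /=.
transitivity (\sum_(b <- divs m) (m == b)%:R * f b).
  apply: eq_bigr => b _.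
  rewrite (eq_bigr (fun a => (mone == a)%:R * ((mmul a b == m)%:R * f b))).
    rewrite (sum_pick (F := fun a => (mmul a b == m)%:R * _)).
      by rewrite mmul1m eq_sym.
    by move=> /mem_divs[] v; rewrite /mone mset0E.
  by move=> a _; rewrite /sone [a == _]eq_sym mulrCA.
by rewrite sum_pick// => /mem_divs[].
Qed.

Lemma smulDl : left_distributive smul +%R.
Proof.
move=> f g h; apply/funext => m.
rewrite [RHS]/(smul f h m + smul g h m) !(smulE _ _ (fsubset_refl _)).
rewrite -[RHS]big_split; apply: eq_bigr => a _ /=; rewrite -[RHS]big_split.
by apply: eq_bigr => b _ /=; rewrite -[RHS]mulrDr -[in RHS]mulrDl.
Qed.

Lemma sone_neq0 : sone != 0.
Proof.
apply/eqP => /(congr1 (fun f : series => f mone)).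
by rewrite /sone eqxx => /eqP; rewrite oner_eq0.
Qed.

HB.instance Definition _ := GRing.Zmodule_isComNzRing.Build series
  smulA smulC smul1s smulDl sone_neq0.

Lemma sscalerAl (c : rat) f g : c *: (f * g) = c *: f * g.
Proof.
apply/funext => m; transitivity (c * smul f g m : rat) => //.
transitivity (smul (c *: f) g m) => //.
rewrite !(smulE _ _ (fsubset_refl _)) mulr_sumr; apply: eq_bigr => a _.
rewrite mulr_sumr; apply: eq_bigr => b _.
by rewrite mulrCA; congr (_ * _); rewrite mulrA.
Qed.

HB.instance Definition _ := GRing.Lmodule_isLalgebra.Build rat series sscalerAl.
HB.instance Definition _ := GRing.Lalgebra_isComAlgebra.Build rat series.

End Series.

Section Polysymmetric.
Local Open Scope classical_set_scope.
Local Open Scope ring_scope.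

(* The series f with every variable replaced by its r-th power. *)
Definition subst_pow (r : nat) (f : series) : series := fun m =>
  \sum_(m' \in [set m' : monom | mpow r m' = m]) f m'.

Definition Eplus (d : nat) : series := fun m =>
  (uniq m && (mdegree m == d))%:R.
Definition Eminus (d : nat) : series := fun m =>
  if uniq m && (mdegree m == d) then (-1) ^+ size m else 0.

Definition Eplus_seq (delta : seq (nat * nat)) : series :=
  \prod_(b <- delta) subst_pow b.2 (Eplus b.1).
Definition Eminus_seq (delta : seq (nat * nat)) : series :=
  \prod_(b <- delta) subst_pow b.2 (Eminus b.1).

End Polysymmetric.

Definition is_part (lam : seq nat) : bool :=
  all (leq 1) lam && sorted geq lam.

(* Semistandard tableaux of shape lam, as lists of rows.  The alphabet is nat
   with 0 as its first letter, to match the indexing of the variables. *)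
Definition is_ssyt (lam : seq nat) (t : seq (seq nat)) : Prop :=
  [/\ shape t = lam, all (sorted leq) t &
      forall i j, i.+1 < size t -> j < size (nth [::] t i.+1) ->
        nth 0 (nth [::] t i) j < nth 0 (nth [::] t i.+1) j].

Definition ssyt_monom (k : nat) (t : seq (seq nat)) : monom :=
  seq_mset [seq (k.-1, j) | j <- flatten t].

Section Schur.
Local Open Scope classical_set_scope.
Local Open Scope ring_scope.

(* The Schur function of shape lam in x_{k,1}, x_{k,2}, ..., for 1 <= k. *)
Definition schur (k : nat) (lam : seq nat) : series := fun m =>
  \sum_(t \in [set t | is_ssyt lam t /\ ssyt_monom k t = m]) (1 : rat).

End Schur.

(* The block d^m is the pair (d, m). *)
Definition is_block (b : nat * nat) : bool := (0 < b.1) && (0 < b.2).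
Definition block_ge (b c : nat * nat) : bool :=
  (c.1 < b.1) || (b.1 == c.1) && (c.2 <= b.2).
Definition is_type (tau : seq (nat * nat)) : bool :=
  all is_block tau && sorted block_ge tau.
Definition restr (tau : seq (nat * nat)) (k : nat) : seq nat :=
  [seq b.2 | b <- tau & b.1 == k].
Definition maxdeg (tau : seq (nat * nat)) : nat := \max_(b <- tau) b.1.

(* The factors of degree k > maxdeg tau are those of the empty partition, and
   equal to 1. *)
Definition stensor (tau : seq (nat * nat)) : series :=
  (\prod_(1 <= k < (maxdeg tau).+1) schur k (restr tau k))%R.

Section Ribbons.
Local Open Scope fset_scope.

(* Boxes are pairs (row, column), both starting at 1. *)
Definition dg (mu : seq nat) : {fset nat * nat} :=
  [fset b in [seq (i, j) | i <- iota 1 (size mu), j <- iota 1 (nth 0 mu i.-1)]].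
Definition skew (nu mu : seq nat) : {fset nat * nat} := dg nu `\` dg mu.

Definition ribbon_step (b c : nat * nat) : bool :=
  (c.1 == b.1) && (c.2.+1 == b.2) || (c.1 == b.1.+1) && (c.2 == b.2).
Definition is_ribbon (r : nat) (R : {fset nat * nat}) : Prop :=
  exists b : seq (nat * nat),
    [/\ size b = r, uniq b, R = [fset x in b] & sorted ribbon_step b].

Definition ribbon_sgn (R : {fset nat * nat}) : rat :=
  ((-1) ^+ (#|` [fset b.1 | b in R]|).-1)%R.
Definition left_col (R : {fset nat * nat}) : nat :=
  head 0 (sort leq [seq b.2 | b <- R]).

Definition layer (g : seq (seq nat)) (i : nat) : {fset nat * nat} :=
  skew (nth [::] g i.+1) (nth [::] g i).

Definition dual_chain (r n : nat) (lam mu : seq nat) (g : seq (seq nat)) : Prop :=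
  [/\ size g = n.+1, nth [::] g 0 = mu, nth [::] g n = lam, all is_part g &
      (forall i, i < n -> dg (nth [::] g i) `<=` dg (nth [::] g i.+1) /\
                          is_ribbon r (layer g i)) /\
      (forall i, i.+1 < n -> left_col (layer g i.+1) <= left_col (layer g i))].

Definition dual_polyribbon (r n : nat) (lam mu : seq nat) : Prop :=
  exists g, dual_chain r n lam mu g.

(* For 1 <= r the chain is unique when it exists. *)
Definition the_chain (r : nat) (lam mu : seq nat) : seq (seq nat) :=
  xget [::] [set g | exists n, dual_chain r n lam mu g]%classic.
Definition sgn_dual (r : nat) (lam mu : seq nat) : rat :=
  (\prod_(i < (size (the_chain r lam mu)).-1)
     ribbon_sgn (layer (the_chain r lam mu) i))%R.

Definition is_assoc (b : nat * nat) (tau sigma : seq (nat * nat))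
    (lam : seq nat) : Prop :=
  [/\ is_part lam, sumn lam = b.1 & forall k, 0 < k ->
      dual_polyribbon b.2 (count_mem k lam) (restr tau k) (restr sigma k)].

Definition dual_tensor_polyribbon (b : nat * nat)
    (tau sigma : seq (nat * nat)) : Prop :=
  exists lam, is_assoc b tau sigma lam.

(* The associated partition is unique when it exists: its number of parts k is
   the number of boxes of the k-th component, divided by b.2. *)
Definition the_assoc (b : nat * nat) (tau sigma : seq (nat * nat)) : seq nat :=
  xget [::] [set lam | is_assoc b tau sigma lam]%classic.

(* When tau/sigma is a dual tensor polyribbon, its components of degree
   k > maxdeg tau are empty, of sign 1. *)
Definition sgn_plus (b : nat * nat) (tau sigma : seq (nat * nat)) : rat :=
  (\prod_(1 <= k < (maxdeg tau).+1) sgn_dual b.2 (restr tau k) (restr sigma k))%R.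
Definition sgn_minus (b : nat * nat) (tau sigma : seq (nat * nat)) : rat :=
  ((-1) ^+ size (the_assoc b tau sigma) * sgn_plus b tau sigma)%R.

Definition TPRT (tau sigma delta : seq (nat * nat)) :
    set (seq (seq (nat * nat))) :=
  [set T | [/\ size T = (size delta).+1, nth [::] T 0 = sigma,
               nth [::] T (size delta) = tau, all is_type T &
               forall i, i < size delta ->
                 dual_tensor_polyribbon (nth (0, 0) delta i)
                   (nth [::] T i.+1) (nth [::] T i)]]%classic.

Definition tab_sgn_plus (delta : seq (nat * nat)) (T : seq (seq (nat * nat))) :
    rat :=
  (\prod_(i < size delta)
     sgn_plus (nth (0%N, 0%N) delta i) (nth [::] T i.+1) (nth [::] T i))%R.
Definition tab_sgn_minus (delta : seq (nat * nat)) (T : seq (seq (nat * nat))) :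
    rat :=
  (\prod_(i < size delta)
     sgn_minus (nth (0%N, 0%N) delta i) (nth [::] T i.+1) (nth [::] T i))%R.

End Ribbons.

(* The families summed over above and in the expansion of a product are finite,
   as are the sets of tableaux, and only finitely many shapes tau occur. *)
Section Finiteness.
Local Open Scope classical_set_scope.

Lemma finite_seqs (T : choiceType) (A : set T) N : finite_set A ->
  finite_set [set s : seq T | size s <= N /\ forall x, x \in s -> A x].
Proof.
move=> finA; elim: N => [|N IH].
  apply: (@sub_finite_set _ _ [set [::]]); last exact: finite_set1.
  by move=> s /= [] + _; rewrite leqn0 size_eq0 => /eqP.
pose S := [set s : seq T | size s <= N /\ forall x, x \in s -> A x].
apply: (@sub_finite_set _ _ ([set [::]] `|`
   (fun p : T * seq T => p.1 :: p.2) @` (A `*` S))).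
  move=> [|x s] /= [sN sA]; [by left|right; exists (x, s) => //=].
  split; first by apply: sA; rewrite inE eqxx.
  by split=> // y ys; apply: sA; rewrite inE ys orbT.
rewrite finite_setU; split; first exact: finite_set1.
by apply: finite_image; exact: finite_setX.
Qed.

Lemma finite_ltn N : finite_set [set n | n < N].
Proof. exact: finite_II. Qed.

Lemma finite_roots r m : 0 < r -> finite_set [set m' : monom | mpow r m' = m].
Proof.
move=> r0; apply: sub_finite_set (finite_divisors m) => m' /= <- v.
rewrite /mpow fsfun_fun; case: finsuppP => // _.
by rewrite leq_pmull.
Qed.

Lemma finite_ssyt k lam m :
  finite_set [set t | is_ssyt lam t /\ ssyt_monom k t = m].
Proof.
pose A := [set` unzip2 (m : seq (nat * nat))].
pose R := [set s : seq nat | size s <= sumn lam /\ forall x, x \in s -> A x].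
apply: (@sub_finite_set _ _
  [set t | size t <= size lam /\ forall s, s \in t -> R s]); last first.
  by apply/finite_seqs/finite_seqs; exact: finite_seq.
move=> t /= [[sh _ _] tm]; split=> [|s st]; first by rewrite -sh size_map.
have sz : size s \in lam by rewrite -sh; exact: map_f.
split=> [|j js] /=.
  by elim: (lam) sz => //= a l IH; rewrite inE => /predU1P[->|/IH h];
    rewrite ?leq_addr// (leq_trans h) ?leq_addl.
apply/mapP; exists (k.-1, j) => //.
rewrite -tm /ssyt_monom (perm_mem (perm_eq_seq_mset _)).
by apply: map_f; apply/flattenP; exists s.
Qed.

Lemma mem_dg mu i j :
  ((i, j) \in dg mu) = [&& 0 < i <= size mu & 0 < j <= nth 0 mu i.-1].
Proof.
rewrite /dg !inE; apply/allpairsPdep/idP => [[a [b []]]|].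
  by rewrite !mem_iota !add1n !ltnS => ha hb [-> ->]; rewrite ha.
by case/andP=> hi hj; exists i, j; rewrite !mem_iota !add1n !ltnS hi hj.
Qed.

Lemma size_dg mu : all (leq 1) mu -> size mu <= #|` dg mu|.
Proof.
move=> mu0; rewrite -(size_iota 1 (size mu)).
rewrite -(size_map (fun i => (i, 1))); apply: uniq_leq_size.
  by rewrite map_inj_uniq ?iota_uniq// => ? ? [].
move=> _ /mapP[[|i] + ->]; rewrite mem_iota add1n ltnS// mem_dg => /= ilt.
have {}ilt : i < size mu by [].
by rewrite ilt; apply/(allP mu0)/mem_nth.
Qed.

Lemma part_dg mu x : x \in mu -> x <= #|` dg mu|.
Proof.
move=> /(nthP 0)[i ilt <-].
rewrite -(size_iota 1 (nth 0 mu i)) -(size_map (fun j => (i.+1, j))).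
apply: uniq_leq_size; first by rewrite map_inj_uniq ?iota_uniq// => ? ? [].
by move=> _ /mapP[j + ->]; rewrite mem_iota add1n ltnS mem_dg ilt => ->.
Qed.

Lemma dg_dual_polyribbon r n lam mu : dual_polyribbon r n lam mu ->
  #|` dg lam| <= #|` dg mu| + n * r.
Proof.
case=> g [_ <- <- _ [h _]].
suff H i : i <= n -> #|` dg (nth [::] g i)| <= #|` dg (nth [::] g 0)| + i * r.
  exact: H.
elim: i => [|i IH] ilt; first by rewrite addn0.
have [gg [b [sb ub Rb _]]] := h i ilt.
have -> : #|` dg (nth [::] g i.+1)| = #|` dg (nth [::] g i)| + r.
  rewrite -(cardfsID (dg (nth [::] g i)) (dg (nth [::] g i.+1))).
  rewrite (fsetIidPr gg) -sb; congr (_ + _).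
  rewrite -/(skew _ _) -/(layer _ _) Rb -(size_iota 0 (size b)).
  by rewrite size_iota card_fseq undup_id.
by rewrite mulSn [r + _]addnC addnA leq_add2r; exact/IH/ltnW.
Qed.

Lemma part_size_sumn lam : all (leq 1) lam -> size lam <= sumn lam.
Proof. by elim: lam => //= a l IH /andP[a0 /IH h]; rewrite -add1n leq_add. Qed.

Lemma part_mem_sumn lam x : x \in lam -> x <= sumn lam.
Proof.
elim: lam => //= a l IH; rewrite inE => /predU1P[->|/IH h].
  exact: leq_addr.
exact: leq_trans h (leq_addl _ _).
Qed.

Definition bounded K B (tau : seq (nat * nat)) :=
  [/\ is_type tau, forall b, b \in tau -> b.1 <= K &
      forall k, #|` dg (restr tau k)| <= B].

Lemma restr_pos tau k : is_type tau -> all (leq 1) (restr tau k).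
Proof.
case/andP=> /allP h _; apply/allP => _ /mapP[b + ->].
by rewrite mem_filter => /andP[_ /h /andP[]].
Qed.

Lemma size_bounded K tau : (forall b, b \in tau -> b.1 <= K) ->
  size tau = \sum_(k < K.+1) size (restr tau k).
Proof.
elim: tau => [|b tau IH] h; first by rewrite big1.
rewrite /= IH; last by move=> c ct; apply: h; rewrite inE ct orbT.
have bK : b.1 < K.+1 by rewrite ltnS; apply: h; rewrite mem_head.
rewrite (bigD1 (Ordinal bK))//= [in RHS](bigD1 (Ordinal bK))//=.
rewrite /restr /= eqxx /=; congr (_.+1 + _).
apply: eq_bigr => i; rewrite -val_eqE /= eq_sym => /negbTE ib.
by rewrite ib.
Qed.

Lemma finite_bounded K B : finite_set (bounded K B).
Proof.
pose A := [set b : nat * nat | b.1 < K.+1 /\ b.2 < B.+1].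
have fA : finite_set A.
  by apply: sub_finite_set (finite_setX (finite_ltn K.+1) (finite_ltn B.+1)).
apply: sub_finite_set (finite_seqs (K.+1 * B) fA) => tau [ty tK tB] /=; split.
  rewrite (size_bounded tK).
  apply: (@leq_trans (\sum_(k < K.+1) B)).
    by apply: leq_sum => k _; exact: leq_trans (size_dg (restr_pos _ ty)) (tB _).
  by rewrite sum_nat_const card_ord.
move=> b bt; split; rewrite ltnS; first exact: tK.
apply: leq_trans (tB b.1); apply: part_dg.
by apply: map_f; rewrite mem_filter eqxx.
Qed.

Lemma bounded_step K B b tau' tau : bounded K B tau -> is_type tau' ->
  dual_tensor_polyribbon b tau' tau ->
  bounded (K + b.1) (B + b.1 * b.2) tau'.
Proof.
move=> [ty tK tB] ty' [lam [/andP[lam0 _] slam h]]; split=> // [c ct|k].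
  rewrite leqNgt; apply/negP => cK.
  have c0 : 0 < c.1 by apply: leq_ltn_trans cK.
  have := h _ c0; rewrite (count_memPn _); last first.
    apply/negP => /part_mem_sumn; rewrite slam leqNgt.
    by rewrite (leq_ltn_trans _ cK)// leq_addl.
  move=> [g [_ g0 g1 _ _]].
  have : c.2 \in restr tau' c.1 by apply: map_f; rewrite mem_filter eqxx.
  rewrite -g1 g0 => /mapP[e]; rewrite mem_filter => /andP[/eqP ec /tK].
  by rewrite ec leqNgt (leq_ltn_trans _ cK)// leq_addr.
case: k => [|k].
  rewrite /restr (_ : [seq _ <- _ | _] = [::]) /=; last first.
    apply/eqP; rewrite -[_ == _]negbK -has_filter; apply/hasPn => c.
    by case/andP: ty' => /allP + _ => /[apply] /andP[]; rewrite lt0n.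
  by rewrite (_ : dg [::] = fset0) ?cardfs0//; apply/fsetP => -[i j];
    rewrite mem_dg inE; case: i.
apply: leq_trans (dg_dual_polyribbon (h k.+1 isT)) _.
rewrite leq_add ?tB// leq_mul2r -slam (leq_trans (count_size _ _)) ?orbT//.
exact: part_size_sumn.
Qed.

Lemma bounded_TPRT sigma delta : is_type sigma ->
  exists KB : nat * nat, forall tau T, TPRT tau sigma delta T ->
    forall t, t \in T -> bounded KB.1 KB.2 t.
Proof.
move=> ty; pose D := \sum_(b <- delta) (b.1 + b.1 * b.2).
pose K := maxdeg sigma; pose B := \max_(k < K.+1) #|` dg (restr sigma k)|.
have base : bounded K B sigma.
  have bK b : b \in sigma -> b.1 <= K.
    by move=> bs; exact: (leq_bigmax_seq (F := fun c => c.1)).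
  split=> // k; case: (ltnP k K.+1) => kK.
    exact: (leq_bigmax (F := fun i : 'I_K.+1 => #|` dg (restr sigma i)|)
      (Ordinal kK)).
  rewrite /restr (_ : [seq _ <- _ | _] = [::]) /=; last first.
    apply/eqP; rewrite -[_ == _]negbK -has_filter; apply/hasPn => c /bK cK.
    by apply/eqP => e; rewrite e leqNgt kK in cK.
  rewrite (_ : dg [::] = fset0) ?cardfs0//; apply/fsetP => -[i j].
  by rewrite mem_dg inE; case: i.
have mono K1 B1 K2 B2 t : K1 <= K2 -> B1 <= B2 -> bounded K1 B1 t ->
    bounded K2 B2 t.
  move=> KK BB [? h1 h2]; split=> // [b /h1 h|k]; first exact: leq_trans KK.
  exact: leq_trans (h2 k) BB.
exists (K + size delta * D, B + size delta * D) => tau T [sT T0 _ /allP Tt step].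
have H i : i <= size delta -> bounded (K + i * D) (B + i * D) (nth [::] T i).
  elim: i => [|i IH] ilt; first by rewrite T0 !addn0.
  set b := nth (0, 0) delta i.
  have bD : b.1 + b.1 * b.2 <= D.
    rewrite /D (big_nth (0, 0)) big_mkord (bigD1 (Ordinal ilt)) //=.
    exact: leq_addr.
  apply: mono (bounded_step (IH (ltnW ilt)) _ (step i ilt)).
  - by rewrite mulSn [D + _]addnC addnA leq_add2l (leq_trans _ bD)// leq_addr.
  - by rewrite mulSn [D + _]addnC addnA leq_add2l (leq_trans _ bD)// leq_addl.
  - by apply: Tt; rewrite mem_nth ?sT.
move=> t /(nthP [::])[i]; rewrite sT ltnS => ilt <-; apply: mono (H i ilt).
  by rewrite leq_add2l leq_mul2r ilt orbT.
by rewrite leq_add2l leq_mul2r ilt orbT.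
Qed.

Lemma finite_TPRT tau sigma delta : is_type sigma ->
  finite_set (TPRT tau sigma delta).
Proof.
move=> /(bounded_TPRT delta)[[K B] h].
apply: sub_finite_set (finite_seqs (size delta).+1 (finite_bounded K B)).
by move=> T hT; split=> [|t]; [case: hT => ->|exact: h hT _].
Qed.

Lemma finite_shapes sigma delta : is_type sigma ->
  finite_set [set tau | exists T, TPRT tau sigma delta T].
Proof.
move=> /(bounded_TPRT delta)[[K B] h].
apply: sub_finite_set (finite_bounded K B) => tau [T hT].
apply: (h _ _ hT); case: hT => sT _ <- _ _.
by rewrite mem_nth ?sT.
Qed.

End Finiteness.

(* Main.v *)
Require Import Defs.
From mathcomp Require Import all_boot all_order all_algebra finmap multiset.
From mathcomp Require Import mathcomp_extra boolp functions cardinality.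
From mathcomp Require Import classical_sets fsbigop.
From mathcomp Require Import perm zify.

(* In N variables, the Schur polynomial of lambda times the Vandermonde
   determinant is the alternant with exponents lambda_i + N - i, and
   multiplying an alternant by the elementary symmetric polynomial e_n(x^r)
   adds r, in all possible ways, to n of its exponents. The resulting
   alternant is 0 if two exponents coincide, and otherwise a signed alternant
   of the sorted exponents. Reading the exponents as the positions of the
   beads of an abacus, sorting them one raised exponent at a time, from the
   largest to the smallest, adds r-ribbons one by one, with weakly decreasing
   left columns: the surviving choices of the n exponents are the dual
   r^n-polyribbons, with their signs. Since the square-free monomials of
   degree d are the products over k of the square-free monomials of degree
   n_k in the x_{k,j}, for all n with sum of the k n_k equal to d, one factor
   E_{d^r} adds a dual d^r-tensor polyribbon. An identity of formal series is
   checked at each monomial, for which finitely many variables suffice. *)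

Set Implicit Arguments.
Unset Strict Implicit.
Unset Printing Implicit Defensive.

Import GRing.Theory.

(** * Alternants and the branching rule *)

(** The alternant formula holds over any commutative ring and goes by induction on the number of
    variables: [schur_poly] is defined by the branching rule that removes the largest letter, so one
    recursion describes both the quotient of alternants and the tableaux. It is applied in the ring
    of series, where cancelling the Vandermonde determinant requires every difference of two
    variables to be regular. The order of the moves matters. A move of row [q] changes no row below
    [q], so in an increasing list the remaining rows still name their original beads; moreover the
    list can be recovered from its result. Hence the sign read off a chosen chain is well defined,
    and no shape is counted twice. The condition on the total degree couples the components, while
    the Pieri rule equates sums over all sets of rows of one size, not single terms. Families of
    sets of rows are therefore grouped by their sizes. Both signs are handled at once through a
    scalar [u]. *)

Section Cart.
Local Open Scope ring_scope.
Variable T : eqType.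
Implicit Types (s m : seq T) (ss : seq (seq T)).

Fixpoint cart ss : seq (seq T) :=
  if ss is s :: ss' then [seq a :: m | a <- s, m <- cart ss'] else [:: [::]].

Lemma mem_cart x0 ss m :
  reflect (size m = size ss /\
           forall i, (i < size ss)%N -> nth x0 m i \in nth [::] ss i)
          (m \in cart ss).
Proof.
elim: ss m => [|s ss IH] m /=.
  by rewrite inE; apply: (iffP eqP) => [->|[/size0nil]].
apply: (iffP allpairsPdep) => [[a [m' [as_ /IH[sm' hm'] ->]]]|].
  by split=> [|[|i]] //=; rewrite ?sm'// => /hm'.
case: m => [[]//|a m [[sm] hm]]; exists a, m; split=> //; first exact: (hm 0%N).
by apply/IH; split=> // i; exact: (hm i.+1).
Qed.

Lemma cart_uniq ss : all uniq ss -> uniq (cart ss).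
Proof.
elim: ss => //= s ss IH /andP[us /IH u].
by apply: allpairs_uniq => // -[a m] [a' m'] _ _ [-> ->].
Qed.

(** Distributivity over lists, because the range of each sum depends on its row. *)
Lemma prod_sum_cart (R : comNzRingType) x0 ss (F : nat -> T -> R) :
  \prod_(i < size ss) \sum_(a <- nth [::] ss i) F i a =
  \sum_(m <- cart ss) \prod_(i < size ss) F i (nth x0 m i).
Proof.
elim: ss F => [|s ss IH] F /=; first by rewrite big_ord0 big_seq1 big_ord0.
rewrite big_ord_recl /= (IH (fun i => F i.+1)) big_allpairs_dep /= mulr_suml.
apply: eq_bigr => a _; rewrite mulr_sumr; apply: eq_bigr => m _.
by rewrite big_ord_recl.
Qed.

End Cart.

Section Alternants.
Local Open Scope ring_scope.
Variables (R : comNzRingType) (x : nat -> R).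

Definition alternant N (v : nat -> nat) : R :=
  \det (\matrix_(i < N, j < N) x j ^+ v i).

(** The bead positions [f i - i], shifted by [N.-1] to be nonnegative for [i < N]. *)
Definition stair N (f : nat -> nat) i : nat := (f i + (N.-1 - i))%N.

(** These are the shapes left when a horizontal strip, the boxes of the last of [N.+1] letters, is
    removed from [f]. *)
Definition interlacings N (f : nat -> nat) : seq (seq nat) :=
  cart [seq iota (f i.+1) (f i - f i.+1).+1 | i <- iota 0 N].

(** The branching rule. The exponent runs over [N] rows while [mu] has only [N']: by the default 0
    of [nth], row [N'] is removed whole. *)
Fixpoint schur_poly N (f : nat -> nat) : R :=
  if N is N'.+1 then
    \sum_(mu <- interlacings N' f)
      schur_poly N' (nth 0%N mu) * x N' ^+ (\sum_(i < N) (f i - nth 0 mu i))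
  else 1.

Definition vandermonde N : R := \prod_(j < N) \prod_(i < j) (x i - x j).

Lemma interlacingsP N f mu : (forall i, i < N -> f i.+1 <= f i)%N ->
  reflect (size mu = N /\
           forall i, (i < N -> f i.+1 <= nth 0 mu i <= f i)%N)
          (mu \in interlacings N f).
Proof.
move=> fdec; apply: (iffP (mem_cart 0%N _ _)); rewrite size_map size_iota.
  move=> [sm hm]; split=> // i iN; move: (hm i iN) (fdec i iN).
  rewrite (nth_map 0%N) ?size_iota// nth_iota// add0n mem_iota.
  by move: (nth _ mu i) => c; lia.
move=> [sm hm]; split=> // i iN; move: (hm i iN) (fdec i iN).
rewrite (nth_map 0%N) ?size_iota// nth_iota// add0n mem_iota.
by move: (nth _ mu i) => c; lia.
Qed.

(** Multilinearity of the determinant in all its rows simultaneously. *)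
Lemma det_cols_sum N (c : nat -> seq nat) (G : nat -> nat -> 'I_N -> R) :
  \det (\matrix_(i < N, j < N) \sum_(a <- c i) G i a j) =
  \sum_(m <- cart [seq c i | i <- iota 0 N])
    \det (\matrix_(i < N, j < N) G i (nth 0%N m i) j).
Proof.
rewrite /determinant exchange_big /=; apply: eq_bigr => s _.
rewrite -mulr_sumr; congr (_ * _).
under eq_bigr do rewrite mxE.
under [RHS]eq_bigr do under eq_bigr do rewrite mxE.
(* [prod_sum_cart] indexes its factors by [nat]; the value 0 outside ['I_N] is never reached. *)
pose F i a := if (insub i : option 'I_N) is Some i' then G i a (s i') else 0.
pose ss := [seq c i | i <- iota 0 N].
have ssz : size ss = N by rewrite size_map size_iota.
transitivity (\prod_(i < size ss) \sum_(a <- nth [::] ss i) F i a).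
  rewrite ssz; apply: eq_bigr => i _; rewrite (nth_map 0%N) ?size_iota//.
  by rewrite nth_iota// add0n; apply: eq_bigr => a _; rewrite /F valK.
rewrite (prod_sum_cart 0%N) ssz; apply: eq_bigr => m _.
by apply: eq_bigr => i _; rewrite /F valK.
Qed.

(* Subtracting from each row a multiple of the next one clears the last column
   and makes the other entries divisible by [x j - x N]. *)
Lemma alternant_rec N (f : nat -> nat) :
  (forall i, i < N -> f i.+1 <= f i)%N ->
  alternant N.+1 (stair N.+1 f) =
  \prod_(j < N) (x j - x N) *
  \sum_(mu <- interlacings N f)
     alternant N (stair N (nth 0%N mu)) *
       x N ^+ (\sum_(i < N.+1) (f i - nth 0 mu i)).
Proof.
move=> fdec; pose l := stair N.+1 f.
pose U : 'M[R]_N.+1 := \matrix_(i, j)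
  ((i == j)%:R - (j == i.+1 :> nat)%:R * x N ^+ (l i - l i.+1)).
pose A : 'M[R]_N.+1 := \matrix_(i, j) x j ^+ l i.
have dU : \det U = 1.
  rewrite -det_tr det_trig; first by apply: big1 => i _;
    rewrite !mxE eqxx ltn_eqF// mul0r subr0.
  apply/is_trig_mxP => i j ij; rewrite !mxE -val_eqE /=.
  have -> : (j == i :> nat) = false by lia.
  have -> : (i == j.+1 :> nat) = false by lia.
  by rewrite mul0r subrr.
have UA (i : 'I_N.+1) j : (U *m A) i j = if (i < N)%N then
    x j ^+ l i - x N ^+ (l i - l i.+1) * x j ^+ l i.+1 else x j ^+ l i.
  rewrite mxE; under eq_bigr do rewrite !mxE mulrBl.
  rewrite sumrB (bigD1 i)//= eqxx mul1r big1 ?addr0; last first.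
    by move=> k /negbTE; rewrite eq_sym => ->; rewrite mul0r.
  case: ifP => iN.
    rewrite (bigD1 (inord i.+1))//= inordK// eqxx mul1r big1 ?addr0// => k.
    by rewrite -val_eqE /= inordK// => /negbTE ->; rewrite !mul0r.
  rewrite big1 ?subr0// => k _; have -> : (k == i.+1 :> nat) = false.
    by have := ltn_ord k; lia.
  by rewrite !mul0r.
have lE (i : nat) : (i < N)%N -> (l i = (l i - l i.+1) + l i.+1)%N.
  by move=> iN; have := fdec i iN; rewrite /l /stair /=; lia.
have -> : alternant N.+1 (stair N.+1 f) = \det (U *m A).
  by rewrite det_mulmx dU mul1r.
rewrite (expand_det_col _ ord_max) (bigD1 ord_max)//= big1 ?addr0; last first.
  move=> i iN; have {}iN : (i < N)%N.
    by move: iN; rewrite -val_eqE /=; have := ltn_ord i; lia.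
  by rewrite UA iN /= -exprD -lE// subrr mul0r.
rewrite UA ltnn /cofactor -signr_odd oddD addbb expr0 mul1r.
(* Once [x j - x N] is factored out of a difference of powers, the cofactor is a sum over the values
   [a] allowed by interlacing. *)
pose G i a (j : 'I_N) := x j ^+ (a + (N.-1 - i)) * x N ^+ (f i - a).
pose c i := iota (f i.+1) (f i - f i.+1).+1.
have -> : row' ord_max (col' ord_max (U *m A)) =
    (\matrix_(i < N, j < N) \sum_(a <- c i) G i a j) *m
       diag_mx (\row_(j < N) (x j - x N)).
  apply/matrixP => i j.
  transitivity ((U *m A) (lift ord_max i) (lift ord_max j));
    first by rewrite mxE mxE.
  rewrite UA !lift_max ltn_ord mul_mx_diag !mxE.
  rewrite [RHS]mulrC {1}(lE _ (ltn_ord i)) exprD -mulrBl subrXX -mulrA;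
    congr (_ * _).
  rewrite mulr_suml /c -[X in iota X _]addn0 iotaDl big_map.
  have -> : (l i - l i.+1 = (f i - f i.+1).+1)%N.
    have := fdec i (ltn_ord i); have := ltn_ord i; rewrite /l /stair /=; lia.
  rewrite -[X in iota 0 X]subn0 -/(index_iota 0 _) big_mkord.
  (* [subrXX] lists the powers of [x j] in falling order, [iota] lists [a] in rising order. *)
  rewrite (reindex_inj rev_ord_inj) /=.
  apply: eq_bigr => k _; rewrite mulrAC -exprD /G; have hk := ltn_ord k.
  have := fdec i (ltn_ord i); have := ltn_ord i; rewrite /l /stair /= => h1 h2.
  by congr (_ ^+ _ * _ ^+ _); lia.
rewrite det_mulmx det_diag mulrA [RHS]mulrC; congr (_ * _); last first.
  by apply: eq_bigr => j _; rewrite !mxE.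
rewrite det_cols_sum mulr_sumr -/c; apply: eq_big_seq => m.
move=> /(interlacingsP _ fdec) [sm _].
(* The pivot [x N ^+ l N] accounts for the summand [i = N] of the exponent, where [nth 0 m N] is the
   default 0. *)
rewrite /alternant big_ord_recr /= (nth_default _ (eq_leq sm)) subn0.
have -> : l N = f N by rewrite /l /stair /= subnn addn0.
rewrite exprD mulrA mulrC; congr (_ * _).
rewrite -prodrXr.
rewrite /determinant mulr_suml; apply: eq_bigr => s _.
rewrite -mulrA; congr (_ * _); rewrite -big_split /=; apply: eq_bigr => i _.
by rewrite !mxE.
Qed.

(** The bialternant formula: each use of [alternant_rec] splits off the Vandermonde factors that
    contain the last variable. *)
Lemma alternantE N (f : nat -> nat) :
  (forall i, i.+1 < N -> f i.+1 <= f i)%N ->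
  alternant N (stair N f) = vandermonde N * schur_poly N f.
Proof.
elim: N f => [|N IH] f fdec.
  by rewrite /alternant det_mx00 /vandermonde big_ord0 mulr1.
rewrite alternant_rec// /vandermonde big_ord_recr /= -/(vandermonde N).
rewrite [vandermonde N * _]mulrC -mulrA; congr (_ * _); rewrite mulr_sumr.
apply: eq_big_seq => mu /interlacingsP[//|sm hm].
rewrite mulrA IH// => i iN.
have := hm i (ltnW iN); have := hm i.+1 iN; lia.
Qed.

End Alternants.

(** * Bead moves *)

Section BeadMoves.
Variable r : nat.
Hypothesis r_gt0 : 0 < r.
Implicit Types (f : nat -> nat) (qs : seq nat).

Definition decreasing f := forall i, f i.+1 <= f i.

Lemma decreasing_le f i j : decreasing f -> i <= j -> f j <= f i.
Proof.
move=> fdec; elim: j => [|j IH]; first by rewrite leqn0 => /eqP ->.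
rewrite leq_eqVlt => /predU1P[->//|]; rewrite ltnS => /IH; exact: leq_trans.
Qed.

(* Row [i] of the partition [f] carries a bead at position [f i - i].  Raising
   the bead of row [q] by [r] makes it the bead of row [landing f q], and pushes
   the beads it jumps over one row down, unless its new position is occupied. *)
Definition landing f q := find (fun i => f i + q < f q + r + i) (iota 0 q).
Definition unblocked f q := all (fun i => f i + q != f q + r + i) (iota 0 q).
Definition bead_move f q i :=
  if i < landing f q then f i
  else if i == landing f q then f q + r + i - q
  else if i <= q then (f i.-1).+1 else f i.

Lemma landing_le f q : landing f q <= q.
Proof. by rewrite /landing -[X in _ <= X](size_iota 0 q) find_size. Qed.

Lemma before_landing f q i : unblocked f q -> i < landing f q ->
  f q + r + i < f i + q.
Proof.
move=> /allP fr ip; have iq := leq_trans ip (landing_le f q).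
have := before_find 0 ip; rewrite nth_iota// add0n.
have := fr i; rewrite mem_iota add0n iq => /(_ isT); lia.
Qed.

Lemma after_landing f q i : decreasing f -> landing f q <= i <= q ->
  f i + q < f q + r + i.
Proof.
move=> fdec /andP[pi iq].
have [pq|] := ltnP (landing f q) q; last first.
  by move=> qp; have -> : i = q by [lia]; lia.
have : has (fun i => f i + q < f q + r + i) (iota 0 q) by rewrite has_find
  size_iota.
move=> /(nth_find 0); rewrite -/(landing f q) nth_iota// add0n.
by have := decreasing_le fdec pi; lia.
Qed.

Lemma at_landing f q : decreasing f ->
  f (landing f q) + q < f q + r + landing f q.
Proof. by move=> fdec; apply: after_landing; rewrite ?leqnn ?landing_le. Qed.

(** The positions [f i - i] strictly decrease, so the comparison at [p] settles all rows from [p] to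
    [q], and in particular excludes equality there. *)
Lemma landingP f q p : decreasing f -> p <= q ->
  (forall i, i < p -> f q + r + i < f i + q) -> f p + q < f q + r + p ->
  unblocked f q /\ landing f q = p.
Proof.
move=> fdec pq before at_p; split.
  apply/allP => /= i; rewrite mem_iota add0n => /= iq.
  have [/before|pi] := ltnP i p; first lia.
  by have := decreasing_le fdec pi; lia.
have [lp|pl|//] := ltngtP (landing f q) p.
  have lq := leq_trans lp pq.
  have : has (fun i => f i + q < f q + r + i) (iota 0 q) by rewrite has_find
    size_iota.
  move=> /(nth_find 0); rewrite -/(landing f q) nth_iota// add0n.
  by have := before _ lp; lia.
have := before_find 0 pl; rewrite nth_iota ?add0n; first lia.
exact: leq_trans pl (landing_le f q).
Qed.

(** The delicate place is just above the landing row: there the unoccupied position provides the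
    strict inequality between beads that row lengths require. *)
Lemma move_decreasing f q :
  decreasing f -> unblocked f q -> decreasing (bead_move f q).
Proof.
move=> fdec fr i; rewrite /bead_move.
have lq := landing_le f q.
have al := at_landing q fdec.
have [ip|ip] := ltnP i.+1 (landing f q); first by rewrite (ltn_trans _ ip).
have [ip'|ip'] := ltnP i (landing f q).
  have -> : i.+1 == landing f q by lia.
  by have := before_landing fr ip'; lia.
have -> : (i.+1 == landing f q) = false by lia.
rewrite /=; have := fdec i; have [->|ne] := eqVneq i (landing f q).
  by case: ifP; lia.
have := fdec i.-1; rewrite prednK; last lia.
by do 2 (case: ifP); lia.
Qed.

Lemma move_gt f q i : q < i -> bead_move f q i = f i.
Proof. by move=> qi; rewrite /bead_move; have := landing_le f q;
  do 3 (case: ifP; try lia). Qed.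

(** The head moves first. In an increasing list this is the largest bead, and the rows in the tail
    are still those of the original [f]. *)
Fixpoint moves f qs := if qs is q :: qs' then moves (bead_move f q) qs' else f.
Fixpoint movable f qs :=
  if qs is q :: qs' then unblocked f q && movable (bead_move f q) qs' else true.
(** The number of adjacent transpositions that sort the raised exponents; its parity gives the
    sign. *)
Fixpoint jumps f qs :=
  if qs is q :: qs' then q - landing f q + jumps (bead_move f q) qs' else 0.

Lemma moves_decreasing f qs : decreasing f -> movable f qs ->
  decreasing (moves f qs).
Proof. by elim: qs f => //= q qs IH f fdec /andP[/(move_decreasing fdec) /IH].
  Qed.

Lemma moves_gt f qs i : (forall q, q \in qs -> q < i) -> moves f qs i = f i.
Proof.
elim: qs f => //= q qs IH f h; rewrite IH => [|q' q'qs].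
  by apply: move_gt; apply: h; rewrite mem_head.
by apply: h; rewrite inE q'qs orbT.
Qed.

End BeadMoves.

(** * Sorting the raised exponents of an alternant *)

Section AlternantMoves.
Variables (R : comNzRingType) (x : nat -> R) (r : nat).
Hypothesis r_gt0 : 0 < r.
Local Open Scope ring_scope.

Lemma eq_alternant N (v w : nat -> nat) : (forall i, (i < N)%N -> v i = w i) ->
  alternant x N v = alternant x N w.
Proof.
by move=> vw; congr (\det _); apply/matrixP => i j; rewrite !mxE vw.
Qed.

Lemma alternant_repeat N (v : nat -> nat) i j :
  (i < j)%N -> (j < N)%N -> v i = v j -> alternant x N v = 0.
Proof.
move=> ij jN vij; have iN := ltn_trans ij jN.
apply: (@determinant_alternate _ _ _ (Ordinal iN) (Ordinal jN)).
  by rewrite -val_eqE /= neq_ltn ij.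
by move=> k; rewrite !mxE /= vij.
Qed.

Lemma alternant_swap N (v : nat -> nat) i : (i.+1 < N)%N ->
  alternant x N (fun k => v (if k == i then i.+1 else if k == i.+1 then i else
    k))
  = - alternant x N v.
Proof.
move=> iN; have iN' := ltnW iN.
pose s := tperm (Ordinal iN') (Ordinal iN).
rewrite /alternant.
set A := (X in _ = - \det X).
have -> : - \det A = \det (row_perm s A).
  rewrite row_permE det_mulmx det_perm odd_tperm -val_eqE /=.
  by rewrite (ltn_eqF (ltnSn i)) expr1 mulN1r.
congr (\det _); apply/matrixP => a b; rewrite !mxE; congr (_ ^+ v _).
rewrite /s; case: tpermP => [->|->|/eqP + /eqP] /=; rewrite ?eqxx//.
  by case: eqP => //; lia.
by rewrite -!val_eqE /= => /negbTE -> /negbTE ->.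
Qed.

(** The cycle of exponents that [bead_move] performs, a product of [q - p] adjacent
    transpositions. *)
Definition rotate (p q : nat) (v : nat -> nat) (i : nat) : nat :=
  if (i < p)%N then v i else if i == p then v q
  else if (i <= q)%N then v i.-1 else v i.

Lemma alternant_rotate N p q (v : nat -> nat) : (p <= q)%N -> (q < N)%N ->
  alternant x N (rotate p q v) = (-1) ^+ (q - p) * alternant x N v.
Proof.
move=> + qN; move: {2}(q - p)%N (erefl (q - p)%N) => n.
elim: n p => [|n IH] p qp pq.
  have -> : p = q by lia.
  rewrite subnn mul1r; apply: eq_alternant => i _; rewrite /rotate.
  by case: (ltngtP i q) => [||->].
have -> : (q - p = (q - p.+1).+1)%N by lia.
rewrite exprS -mulrA -IH; [|lia|lia].
rewrite mulN1r -(@alternant_swap _ _ p); last lia.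
apply: eq_alternant => i _; rewrite /rotate.
have [->|ip] := eqVneq i p.
  by rewrite ltnn ltnn eqxx.
have [->|ip'] := eqVneq i p.+1.
  by rewrite ltnNge leqnSn /= ltnS leqnn; have -> : (p < q)%N by lia.
have -> : (i < p.+1)%N = (i < p)%N by lia.
by rewrite (negbTE ip').
Qed.

(** [w] holds the raises still pending, all in rows below [q], which the rotation leaves in place. A
    blocked move makes two exponents equal, so the alternant vanishes. *)
Lemma alternant_move N f q (w : nat -> nat) : decreasing f -> (q < N)%N ->
  (forall i, (i <= q)%N -> w i = 0%N) ->
  alternant x N (fun i => stair N f i + r * (i == q) + w i)%N =
  if unblocked r f q then (-1) ^+ (q - landing r f q) *
       alternant x N (fun i => stair N (bead_move r f q) i + w i)%N
  else 0.
Proof.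
move=> fdec qN w0; case: ifPn => fr; last first.
  case/allPn: fr => i; rewrite mem_iota add0n => /= iq; rewrite negbK => /eqP e.
  apply: (@alternant_repeat _ _ i q) => //.
  rewrite !w0// ?(ltnW iq)// eqxx (ltn_eqF iq) /stair; lia.
set p := landing r f q; have pq : (p <= q)%N := landing_le r f q.
set v := (X in alternant _ _ X = _).
suff -> : alternant x N (fun i => stair N (bead_move r f q) i + w i)%N =
    (-1) ^+ (q - p) * alternant x N v by rewrite mulrA -expr2 sqrr_sign mul1r.
rewrite -alternant_rotate//; apply: eq_alternant => i iN.
rewrite /v /rotate /stair /bead_move -/p.
have al := @after_landing r r_gt0 f q _ fdec.
case: ltnP => [ip|pi]; first by rewrite (ltn_eqF (leq_trans ip pq)) muln0 addn0.
case: eqP => [->|/eqP ne].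
  have := al p; rewrite -/p leqnn pq eqxx !w0// => /(_ isT); lia.
case: leqP => [iq|qi].
  rewrite !w0//; last lia.
  have -> : (i.-1 == q) = false by lia.
  lia.
by rewrite (gtn_eqF qi) muln0 addn0.
Qed.

Lemma alternant_moves N f qs : decreasing f -> sorted ltn qs ->
  (forall q, q \in qs -> (q < N)%N) ->
  alternant x N (fun i => stair N f i + r * (i \in qs))%N =
  if movable r f qs then
    (-1) ^+ jumps r f qs * alternant x N (stair N (moves r f qs)) else 0.
Proof.
elim: qs f => [|q qs IH] f fdec /=.
  by move=> _ _; rewrite mul1r; apply: eq_alternant => i _; rewrite muln0 addn0.
rewrite path_sortedE; last exact: ltn_trans.
move=> /andP[/allP qqs sqs] qN.
have q_lt := qN q (mem_head _ _).
transitivity (alternant x N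
    (fun i => stair N f i + r * (i == q) + r * (i \in qs))%N).
  apply: eq_alternant => i _; rewrite inE -addnA -mulnDr; congr (_ + r * _)%N.
  by have [->|//] := eqVneq i q; case: (boolP (q \in qs)) => // /qqs /=;
    rewrite ltnn.
rewrite alternant_move//; last first.
  move=> i iq; case: (boolP (i \in qs)) => [/qqs /=|]; last by rewrite muln0.
  by rewrite ltnNge iq.
case: ifP => //= fr; rewrite IH//; first by case: ifP;
  rewrite ?mulr0// exprD mulrA.
  exact: move_decreasing.
by move=> q' q'qs; apply: qN; rewrite inE q'qs orbT.
Qed.

Definition rows N (S : {set 'I_N}) : seq nat := map val (enum S).

Lemma rows_sorted N (S : {set 'I_N}) : sorted ltn (rows S).
Proof.
rewrite /rows sorted_map /enum_mem; apply: sorted_filter.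
  by move=> i j k /=; exact: ltn_trans.
by rewrite -enumT -sorted_map val_enum_ord iota_ltn_sorted.
Qed.

(** In the Leibniz expansion a permutation [s] matches rows with columns: multiplying by the
    variables in the image of [S] under [s] raises exactly the exponents of the rows in [S]. *)
Lemma alternant_pieri N n (v : nat -> nat) :
  (\sum_(S : {set 'I_N} | #|S| == n) \prod_(j in S) x j ^+ r) * alternant x N v
  = \sum_(S : {set 'I_N} | #|S| == n)
      alternant x N (fun i => v i + r * (i \in rows S))%N.
Proof.
rewrite /alternant /determinant mulr_sumr exchange_big /=;
  apply: eq_bigr => s _.
rewrite mulrCA -mulr_sumr; congr (_ * _); rewrite mulr_suml.
rewrite (reindex_inj (imset_inj (@perm_inj _ s))) /=.
apply: eq_big => [S|S _]; first by rewrite card_imset//; exact: perm_inj.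
rewrite big_imset /=; last by move=> ? ? _ _; exact: perm_inj.
rewrite [X in X * _]big_mkcond -big_split /=; apply: eq_bigr => i _;
  rewrite !mxE.
rewrite /rows mem_map; last exact: val_inj.
rewrite mem_enum; case: (i \in S); first by rewrite muln1 mulrC exprD.
by rewrite muln0 addn0 mul1r.
Qed.

Lemma schur_poly_pieri N n f : decreasing f -> (GRing.lreg (vandermonde x N)) ->
  schur_poly x N f * (\sum_(S : {set 'I_N} | #|S| == n) \prod_(j in S) x j ^+ r)
  = \sum_(S : {set 'I_N} | #|S| == n)
      (movable r f (rows S))%:R * (-1) ^+ jumps r f (rows S) *
      schur_poly x N (moves r f (rows S)).
Proof.
move=> fdec reg; apply: reg; rewrite mulrA -alternantE// mulrC alternant_pieri.
rewrite mulr_sumr; apply: eq_bigr => S _.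
rewrite alternant_moves//.
- case: ifP => mov; last by rewrite !mul0r mulr0.
  rewrite mul1r mulrCA -alternantE// => i _; exact: moves_decreasing.
- exact: rows_sorted.
- by move=> _ /mapP[q _ ->]; exact: ltn_ord.
Qed.

End AlternantMoves.

Section MoreMoves.
Variable r : nat.
Hypothesis r_gt0 : 0 < r.
Implicit Types (f : nat -> nat) (qs : seq nat).

Lemma move_ge f q i : decreasing f -> unblocked r f q ->
  f i + (landing r f q <= i <= q) <= bead_move r f q i.
Proof.
move=> fdec fr; rewrite /bead_move;
  have al := @after_landing r r_gt0 f q i fdec.
have := fdec i.-1; case: (ltnP i) => /= pi; first by rewrite addn0.
have [->|ne] := eqVneq i (landing r f q) => /=.
  by have := at_landing r_gt0 q fdec; rewrite landing_le; lia.
by rewrite prednK; [case: (leqP i q) => /=; lia|lia].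
Qed.

Lemma moves_ge f qs i : decreasing f -> movable r f qs ->
  f i <= moves r f qs i.
Proof.
elim: qs f => //= q qs IH f fdec /andP[fr mv].
apply: leq_trans (IH _ (move_decreasing r_gt0 fdec fr) mv).
exact: leq_trans (leq_addr _ _) (move_ge _ fdec fr).
Qed.

(** This bounds the rows that may be moved: each of them is a nonempty row of the result, so it is
    smaller than the number of parts. *)
Lemma moves_row_gt0 f qs q : decreasing f -> movable r f qs -> q \in qs ->
  0 < moves r f qs q.
Proof.
elim: qs f => //= q' qs IH f fdec /andP[fr mv].
have fdec' := move_decreasing r_gt0 fdec fr.
rewrite inE => /predU1P[->|/IH]; last exact.
apply: leq_trans (moves_ge _ fdec' mv).
by have := move_ge q' fdec fr; rewrite leqnn landing_le; lia.
Qed.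

(* Later moves start lower, so that the topmost row changed by a sequence of
   moves, and its final length, are determined by the first move. *)
Lemma moves_low f qs p i : decreasing f -> sorted ltn qs -> movable r f qs ->
  (forall q, q \in qs -> f q + r + p < f p + q) -> i <= p ->
  moves r f qs i = f i.
Proof.
elim: qs f => //= q qs IH f fdec + /andP[fr mv] low ip.
rewrite path_sortedE; last exact: ltn_trans.
move=> /andP[/allP qqs sqs].
have lowq := low q (mem_head _ _).
have pq : p <= q by rewrite leqNgt; apply/negP => qp;
  have := decreasing_le fdec (ltnW qp); lia.
have pl : p < landing r f q.
  rewrite ltnNge; apply/negP => lp.
  by have := @after_landing r r_gt0 f q p fdec; rewrite lp pq => /(_ isT); lia.
have same j : j <= p -> bead_move r f q j = f j.
  by move=> jp; rewrite /bead_move (leq_ltn_trans jp pl).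
rewrite IH ?same//; first exact: move_decreasing.
move=> q' q'qs; rewrite move_gt//; last exact: qqs.
by apply: low; rewrite inE q'qs orbT.
Qed.

(** A later bead starts below the bead of row [q] and remains below it after both gain [r]. The
    landing row of the first move is therefore final. *)
Lemma moves_first_row f q qs : decreasing f -> sorted ltn (q :: qs) ->
  movable r f (q :: qs) ->
  (forall i, i < landing r f q -> moves r f (q :: qs) i = f i) /\
  moves r f (q :: qs) (landing r f q) + q = f q + r + landing r f q.
Proof.
move=> fdec /=; rewrite path_sortedE; last exact: ltn_trans.
move=> /andP[/allP qqs sqs] /andP[fr mv]; set p := landing r f q.
have pq : p <= q := landing_le r f q.
have al := at_landing r_gt0 q fdec; rewrite -/p in al.
have at_p : bead_move r f q p = f q + r + p - q by rewrite /bead_move ltnn eqxx.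
have low i : i <= p -> moves r (bead_move r f q) qs i = bead_move r f q i.
  apply: moves_low => //; first exact: move_decreasing.
  move=> q' /qqs /= qq'; rewrite move_gt// at_p.
  by have := decreasing_le fdec (ltnW qq'); lia.
split=> [i ip|]; first by rewrite low ?(ltnW ip)// /bead_move ip.
by rewrite low// at_p; lia.
Qed.

(** The topmost changed row and its new length yield the position [f q - q], which identifies [q]
    because positions are distinct; the tails are then compared by induction. *)
Lemma moves_inj f qs qs' : decreasing f -> sorted ltn qs -> sorted ltn qs' ->
  movable r f qs -> movable r f qs' -> moves r f qs =1 moves r f qs' -> qs =
    qs'.
Proof.
elim: qs f qs' => [|q qs IH] f [|q' qs'] fdec // s s' m m' e.
- have [_ h] := moves_first_row fdec s' m'; rewrite -e /= in h.
  by have := at_landing r_gt0 q' fdec; lia.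
- have [_ h] := moves_first_row fdec s m; rewrite e /= in h.
  by have := at_landing r_gt0 q fdec; lia.
have [lo at_p] := moves_first_row fdec s m.
have [lo' at_p'] := moves_first_row fdec s' m'.
have al := at_landing r_gt0 q fdec; have al' := at_landing r_gt0 q' fdec.
have pp : landing r f q = landing r f q'.
  have [/lo'|/lo|//] := ltngtP (landing r f q) (landing r f q').
    by rewrite -e => h; rewrite h in at_p; lia.
  by rewrite e => h; rewrite h in at_p'; lia.
rewrite e pp in at_p.
have qq : q = q'.
  have [h|h|//] := ltngtP q q'; have := decreasing_le fdec (ltnW h); lia.
move: m m' s s' => /= /andP[fr m] /andP[_ m'] /path_sorted s /path_sorted s'.
subst q'; congr (_ :: _); apply: (IH (bead_move r f q)) => //.
exact: move_decreasing.
Qed.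

End MoreMoves.

(** * Partitions as weakly decreasing functions *)

Section Partitions.

Lemma part_decreasing mu : is_part mu -> decreasing (nth 0 mu).
Proof.
move=> /andP[_ /(sortedP 0) h] i.
by have [im|im] := ltnP i.+1 (size mu); [exact: h|rewrite (nth_default _ im)].
Qed.

Lemma part_nth_gt0 mu i : is_part mu -> (0 < nth 0 mu i) = (i < size mu).
Proof.
move=> /andP[/allP h _]; case: (ltnP i (size mu)) => [im|im];
  first by rewrite (h _ (mem_nth 0 im)).
by rewrite nth_default.
Qed.

Lemma part_ext mu nu : is_part mu -> is_part nu ->
  nth 0 mu =1 nth 0 nu -> mu = nu.
Proof.
move=> pm pn e; apply: (@eq_from_nth _ 0) => // .
apply/eqP; rewrite eqn_leq.
rewrite leqNgt -(part_nth_gt0 _ pm) e (part_nth_gt0 _ pn) ltnn /=.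
by rewrite leqNgt -(part_nth_gt0 _ pn) -e (part_nth_gt0 _ pm) ltnn.
Qed.

Definition strip N (f : nat -> nat) : seq nat := [seq x <- mkseq f N | 0 < x].

(** The zeros of a decreasing [f] form a tail, and [nth 0] restores them after the filter. *)
Lemma stripP N f : decreasing f -> (forall i, N <= i -> f i = 0) ->
  is_part (strip N f) /\ nth 0 (strip N f) =1 f.
Proof.
move=> fdec f0; split.
  rewrite /is_part filter_all /=; apply: sorted_filter.
    by move=> a b c /= ab cb; exact: leq_trans cb ab.
  apply/(sortedP 0) => i; rewrite size_mkseq => iN.
  by rewrite !nth_mkseq ?(ltnW iN)//; exact: fdec.
move=> i; rewrite /strip /mkseq.
elim: N f fdec f0 i => [|N IH] f fdec f0 i; first by rewrite nth_nil f0.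
rewrite /= -[1]addn0 iotaDl -map_comp.
have g0 : forall i, N <= i -> (f \o addn 1) i = 0 by move=> j Nj; apply: f0.
have gdec : decreasing (f \o addn 1) by move=> j; exact: fdec.
case: ifP => [f00|/negbT]; first by case: i => [//|i];
  rewrite /= (IH _ gdec g0).
rewrite -leqNgt leqn0 => /eqP f00; rewrite (IH _ gdec g0).
have z j : f j = 0 by apply/eqP; rewrite -leqn0 -f00; exact: decreasing_le.
by rewrite /= !z.
Qed.

Lemma mem_dgS mu i j : ((i.+1, j.+1) \in dg mu) = (j < nth 0 mu i).
Proof.
rewrite mem_dg /=; case: (ltnP i) => //= im.
by rewrite nth_default.
Qed.

Lemma dg_subP mu nu :
  reflect (forall i, nth 0 mu i <= nth 0 nu i) (dg mu `<=` dg nu)%fset.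
Proof.
apply: (iffP (@fsubsetP _ (dg mu) (dg nu))) => [h i|h [i j]].
  case E: (nth 0 mu i) => [//|j].
  by have := h (i.+1, j.+1); rewrite !mem_dgS E; exact.
case: i j => [|i] [|j]; rewrite ?mem_dgS; try by rewrite mem_dg /= ?andbF.
by move=> /leq_trans; exact.
Qed.

Lemma mem_skew mu nu i j : ((i.+1, j.+1) \in Defs.skew nu mu) =
  (nth 0 mu i <= j < nth 0 nu i).
Proof. by rewrite /Defs.skew in_fsetD !mem_dgS -leqNgt. Qed.

Lemma mem_skew_pos mu nu b : b \in Defs.skew nu mu -> 0 < b.1 /\ 0 < b.2.
Proof.
by case: b => i j; rewrite /Defs.skew in_fsetD => /andP[_];
  rewrite mem_dg => /andP[/andP[-> _] /andP[-> _]].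
Qed.

End Partitions.

(** * The walk through the boxes of a ribbon *)

Section Ribbons.

(** Listed from right to left, the direction in which [ribbon_step] walks along a row. *)
Fixpoint row_segment (i a n : nat) : seq (nat * nat) :=
  if n is n'.+1 then (i, a + n) :: row_segment i a n' else [::].

Lemma mem_row_segment i a n (b : nat * nat) :
  (b \in row_segment i a n) = (b.1 == i) && (a < b.2 <= a + n).
Proof.
elim: n => [|n IH] /=; first by rewrite in_nil; lia.
by rewrite inE IH; case: b {IH} => x y; rewrite xpair_eqE /=; lia.
Qed.

Lemma row_segment_uniq i a n : uniq (row_segment i a n).
Proof. by elim: n => //= n ->; rewrite mem_row_segment /=; lia. Qed.

Lemma row_segment_path i a n :
  path ribbon_step (i, a + n.+1) (row_segment i a n) /\
  last (i, a + n.+1) (row_segment i a n) = (i, a.+1).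
Proof.
elim: n => [|n [IH1 IH2]] /=; first by rewrite addn1.
by rewrite IH1 IH2 /ribbon_step /= !addnS !eqxx.
Qed.

Lemma size_row_segment i a n : size (row_segment i a n) = n.
Proof. by elim: n => //= n ->. Qed.

Lemma row_segment_cons i a c : a < c ->
  (i, c) :: row_segment i a (c - a).-1 = row_segment i a (c - a).
Proof.
move=> ac; have -> : c - a = (c - a).-1.+1 by lia.
by congr ((_, _) :: _); lia.
Qed.

(** Consecutive rows share exactly one column, so the walk goes down from the leftmost box of a row
    to the rightmost box of the next. The number of boxes telescopes to [g p - f (p + k) + k]. *)
Lemma ribbon_path (f g : nat -> nat) p k :
  (forall i, p <= i <= p + k -> f i < g i) ->
  (forall i, p <= i < p + k -> g i.+1 = (f i).+1) ->
  exists b, [/\ path ribbon_step (p.+1, g p) b, uniq ((p.+1, g p) :: b),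
    size b + (f (p + k)).+1 = g p + k &
    forall x, x \in (p.+1, g p) :: b =
      [&& p < x.1 <= (p + k).+1 & f x.1.-1 < x.2 <= g x.1.-1]].
Proof.
elim: k p => [|k IH] p fg step.
  have fgp : f p < g p by apply: fg; rewrite leqnn addn0 leqnn.
  have E := row_segment_cons p.+1 fgp.
  exists (row_segment p.+1 (f p) (g p - f p).-1); rewrite E; split.
  - have [+ _] := row_segment_path p.+1 (f p) (g p - f p).-1.
    by rewrite prednK ?subn_gt0// subnKC// ltnW.
  - exact: row_segment_uniq.
  - by rewrite size_row_segment addn0; lia.
  - move=> [x y]; rewrite mem_row_segment /= addn0 subnKC ?(ltnW fgp)//.
    have [->|ne] := eqVneq x p.+1; first by rewrite !leqnn.
    by have -> : (p < x <= p.+1) = false by lia.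
have fgp : f p < g p by apply: fg; rewrite leqnn leq_addr.
have E := row_segment_cons p.+1 fgp.
have [|i hi|b [pb ub sb mb]] := IH p.+1; try by move=> i hi; apply: fg; lia.
  by apply: step; lia.
exists (row_segment p.+1 (f p) (g p - f p).-1 ++ (p.+2, g p.+1) :: b).
have [rp rl] := row_segment_path p.+1 (f p) (g p - f p).-1.
rewrite prednK ?subn_gt0// subnKC ?(ltnW fgp)// in rp rl.
rewrite -cat_cons E; split.
- rewrite cat_path rp rl /= pb andbT /ribbon_step /= step ?eqxx ?orbT//.
  by rewrite leqnn; lia.
- rewrite cat_uniq row_segment_uniq ub andbT andTb; apply/hasPn => x.
  case: x => x y; rewrite mb mem_row_segment /=.
  by move=> /andP[/andP[px _] _]; rewrite (gtn_eqF px).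
- have gp : g p.+1 = (f p).+1 by apply: step; lia.
  by move: sb; rewrite gp addSnnS size_cat size_row_segment /=; lia.
- move=> [x y]; rewrite mem_cat mem_row_segment mb /= subnKC ?(ltnW fgp)//.
  have [->|ne] := eqVneq x p.+1.
    by rewrite [p.+1.-1]/=; case: (f p < y); case: (y <= g p); lia.
  by case: (f x.-1 < y); case: (y <= g x.-1); move: x ne => /= x; lia.
Qed.

End Ribbons.

(** * Ribbons *)

Lemma left_col_min (R : {fset nat * nat}) c :
  (exists2 x, x \in R & x.2 = c) -> (forall x, x \in R -> c <= x.2) ->
  left_col R = c.
Proof.
move=> [x xR xc] cmin; rewrite /left_col; set s := [seq b.2 | b <- R].
have cs : c \in sort leq s by rewrite mem_sort -xc; apply: map_f.
have : sorted leq (sort leq s) by apply: sort_sorted; exact: leq_total.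
case E : (sort leq s) cs => [//|a t] /= cs sat; apply/eqP; rewrite eqn_leq.
apply/andP; split.
  move: cs; rewrite inE => /predU1P[->//|ct].
  by have /allP := order_path_min leq_trans sat; exact.
have : a \in s by rewrite -(mem_sort leq) E mem_head.
by move=> /mapP[y yR ->]; exact: cmin.
Qed.

Section RibbonMoves.
Variable r : nat.
Hypothesis r_gt0 : 0 < r.
Variables mu nu : seq nat.
Hypotheses (part_mu : is_part mu) (part_nu : is_part nu).
Let f := nth 0 mu.
Let g := nth 0 nu.
Let fdec : decreasing f := part_decreasing part_mu.
Let gdec : decreasing g := part_decreasing part_nu.

Section OneMove.
Variable q : nat.
Hypothesis unblocked_q : unblocked r f q.
Hypothesis nuE : g =1 bead_move r f q.
Let p := landing r f q.

Lemma mem_skew_move (x : nat * nat) : (x \in Defs.skew nu mu) =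
  [&& p < x.1 <= q.+1 & f x.1.-1 < x.2 <= g x.1.-1].
Proof.
case: x => -[|i] [|j].
- by apply/negbTE/negP => /mem_skew_pos[].
- by apply/negbTE/negP => /mem_skew_pos[].
- by rewrite [RHS]/= andbF; apply/negbTE/negP => /mem_skew_pos[].
rewrite mem_skew -/f -/g !ltnS /=; case: (boolP (p <= i <= q)) => //= ipq.
rewrite nuE /bead_move -/p.
have [ip|pi] := ltnP i p; first by case: ltngtP => //; lia.
have -> : (i == p) = false by have := landing_le r f q; rewrite -/p; lia.
have -> : (i <= q) = false by lia.
by move: (f i) => a; lia.
Qed.

Lemma move_rows i : p <= i <= q -> f i < g i.
Proof. by move=> ipq; have := move_ge r_gt0 i fdec unblocked_q;
  rewrite nuE -/p ipq; lia. Qed.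

Lemma move_steps i : p <= i < q -> g i.+1 = (f i).+1.
Proof.
move=> ipq; rewrite nuE /bead_move -/p.
have -> : (i.+1 < p) = false by lia.
have -> : (i.+1 == p) = false by lia.
by have -> : i < q by lia.
Qed.

Lemma move_first : g p + q = f q + r + p.
Proof.
rewrite nuE /bead_move -/p ltnn eqxx.
by have := at_landing r_gt0 q fdec; rewrite -/p; lia.
Qed.

Lemma move_dg_sub : (dg mu `<=` dg nu)%fset.
Proof.
apply/dg_subP => i; rewrite -/(f i) -/(g i) nuE.
by apply: leq_trans (move_ge r_gt0 i fdec unblocked_q); exact: leq_addr.
Qed.

(** [ribbon_path] produces [g p - f q + (q - p)] boxes, which [move_first] evaluates to [r]. *)
Lemma move_ribbon : is_ribbon r (Defs.skew nu mu).
Proof.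
have pq : p <= q := landing_le r f q.
have kE : p + (q - p) = q by exact: subnKC.
have [||b [pb ub sb mb]] := @ribbon_path f g p (q - p); rewrite ?kE.
- exact: move_rows.
- exact: move_steps.
rewrite kE in sb mb; exists ((p.+1, g p) :: b); split=> //.
  by have := move_first; rewrite /=; lia.
by apply/fsetP => x; rewrite mem_skew_move in_fset mb.
Qed.

(** Row [q] is the lowest row of the ribbon, and rows of [f] shorten downwards, so the leftmost
    column is met there. *)
Lemma move_left_col : left_col (Defs.skew nu mu) = (f q).+1.
Proof.
have pq : p <= q := landing_le r f q.
apply: left_col_min.
  exists (q.+1, (f q).+1) => //; rewrite mem_skew_move /= !ltnS leqnn pq /=.
  by rewrite leqnn move_rows// pq leqnn.
move=> x; rewrite mem_skew_move => /andP[/andP[_ xq] /andP[xf _]].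
by apply: leq_trans xf; rewrite ltnS; apply: decreasing_le => //; lia.
Qed.

Lemma move_ribbon_sgn :
  ribbon_sgn (Defs.skew nu mu) = ((-1) ^+ (q - p))%R.
Proof.
have pq : p <= q := landing_le r f q.
rewrite /ribbon_sgn; congr (_ ^+ _)%R.
rewrite (_ : [fset b.1 | b in _]%fset = [fset i in iota p.+1 (q - p).+1]%fset).
  by rewrite card_fseq undup_id ?iota_uniq// size_iota.
apply/fsetP => i; rewrite in_fset mem_iota; apply/imfsetP/idP => /=.
  by move=> [x xR ->]; move: xR; rewrite mem_skew_move; lia.
move=> hi; exists (i, g i.-1) => //; rewrite mem_skew_move /= leqnn.
by rewrite move_rows; lia.
Qed.

End OneMove.

(** If the walk starts in row [p] and ends in row [q], the shape of [g] on these rows is forced by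
    the walk, and its length [r] fixes [g p]. This is the move of the bead of row [q] landing in row
    [p]. *)
Lemma ribbon_is_move :
  (dg mu `<=` dg nu)%fset -> is_ribbon r (Defs.skew nu mu) ->
  exists2 q, unblocked r f q & g =1 bead_move r f q.
Proof.
move=> /dg_subP fg [b [sb ub Rb /(sortedP (0, 0)) pb]].
rewrite sb in pb.
have memb i j : ((i.+1, j.+1) \in b) = (f i <= j < g i).
  by rewrite -mem_skew Rb in_fset.
have pos x : x \in b -> 0 < x.1 /\ 0 < x.2.
  by move=> xb; apply: (@mem_skew_pos mu nu); rewrite Rb in_fset.
pose nb s := nth (0, 0) b s.
have nbP s : s < r -> exists i j, nb s = (i.+1, j.+1) /\ f i <= j < g i.
  move=> sr; have xb : nb s \in b by rewrite mem_nth// sb.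
  case: (nb s) xb (pos _ xb) => [[|i] [|j]] xb [] //= _ _.
  by exists i, j; rewrite -memb.
(* The last equation says that column minus row drops by exactly one at each step. *)
have mono s t : s <= t -> t < r -> [/\ (nb s).1 <= (nb t).1, (nb t).2 <= (nb
  s).2
    & (nb t).1 + (nb s).2 = (nb s).1 + (nb t).2 + (t - s)].
  elim: t => [|t IH] st tr; first by have -> : s = 0 by [lia]; split=> //; lia.
  have [->|ne] := eqVneq s t.+1; first by split=> //; lia.
  have [||h1 h2 h3] := IH; try lia.
  by have := pb t tr; rewrite /ribbon_step -/(nb t) -/(nb t.+1) => h; split;
    lia.
have at_ i j : f i <= j < g i -> exists2 s, s < r & nb s = (i.+1, j.+1).
  rewrite -memb => xb; exists (index (i.+1, j.+1) b); last exact: nth_index.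
  by rewrite -sb index_mem.
have [p [jp [nb0 fgp]]] := nbP 0 r_gt0.
have rr : r.-1 < r by rewrite prednK.
have [q [jq [nbr fgq]]] := nbP r.-1 rr.
have between i : f i < g i -> p <= i <= q.
  move=> fgi; have [|s sr nbs] := at_ i (f i); first by rewrite leqnn.
  have [h1 _ _] := mono 0 s (leq0n _) sr.
  have [|h2 _ _] := mono s r.-1 _ rr; first lia.
  by move: h1 h2; rewrite nb0 nbs nbr /=; lia.
(* From the leftmost box of row [i] the walk cannot go left, so it goes down. The rightmost box of
   row [i.+1] is visited no earlier than [s], hence lies no further right than column [(f i).+1]. *)
have next i : i < q -> f i < g i -> f i.+1 < g i.+1 /\ g i.+1 = (f i).+1.
  move=> iq fgi; have [|s sr nbs] := at_ i (f i); first by rewrite leqnn.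
  have sr1 : s.+1 < r.
    rewrite ltn_neqAle sr andbT; apply/eqP => e; move: nbr.
    by rewrite -e /= nbs => -[]; lia.
  have [i' [j' [nbs1 fgi']]] := nbP _ sr1.
  have := pb s sr1; rewrite /ribbon_step -/(nb s) -/(nb s.+1) nbs nbs1 /=.
  rewrite !eqSS => /orP[/andP[/eqP ei ej]|/andP[/eqP ei /eqP ej]]; subst.
    by move: fgi'; lia.
  split; first lia.
  have [|t tr nbt] := at_ i.+1 (g i.+1).-1; first by move: fgi'; lia.
  have st : s <= t.
    rewrite leqNgt; apply/negP => ts.
    by have [h1 _ _] := mono t s (ltnW ts) sr; move: h1; rewrite nbs nbt /=;
      lia.
  have [_ h2 _] := mono s t st tr; move: h2; rewrite nbs nbt /=.
  by move: fgi'; lia.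
have fgq' : f q < g q by lia.
have fgp' : f p < g p by lia.
have /andP[_ pq] := between p fgp'.
have fgi i : p <= i <= q -> f i < g i.
  elim: i => [|i IH] hi; first by have <- : p = 0 by [lia].
  have [<-//|ne] := eqVneq p i.+1.
  by have [||] := next i; [lia|apply: IH; lia|].
have step i : p <= i < q -> g i.+1 = (f i).+1.
  by move=> hi; have [||] := next i; [lia|apply: fgi; lia|].
have same i : ~~ (p <= i <= q) -> g i = f i.
  by move=> hi; have := fg i; have := between i; rewrite -/(f i) -/(g i); lia.
have jpE : jp.+1 = g p.
  have [|s sr nbs] := at_ p (g p).-1; first by lia.
  by have [_ h _] := mono 0 s (leq0n _) sr; move: h; rewrite nb0 nbs /=; lia.
have jqE : jq = f q.
  have [|s sr nbs] := at_ q (f q); first by lia.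
  have [|_ h _] := mono s r.-1 _ rr; first lia.
  by move: h; rewrite nbs nbr /=; lia.
have count : g p + q = f q + r + p.
  have [_ _ h] := mono 0 r.-1 (leq0n _) rr.
  by move: h; rewrite nb0 nbr /= jpE jqE; lia.
(* Rows above [p] are unchanged, so [g p <= g i = f i] there: those beads lie beyond the new
   position. *)
have [||frq lq] := @landingP r r_gt0 f q p fdec pq.
- move=> i ip; have := decreasing_le gdec (ltnW ip).
  by rewrite (same i); lia.
- by lia.
exists q => // i; rewrite /bead_move lq.
have [ip|pi] := ltnP i p; first by rewrite same; lia.
have [->|ne] := eqVneq i p; first by lia.
case: leqP => [iq|qi]; last by rewrite same; lia.
by rewrite -step ?prednK//; lia.
Qed.

End RibbonMoves.

(** * Polyribbons as increasing sequences of bead moves *)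

Section Chains.
Variable r : nat.
Hypothesis r_gt0 : 0 < r.

(** Weakly decreasing left columns amount to strictly increasing rows [q]. The left column of the
    first layer is part of the conclusion so that the induction can compare it with the ribbon in
    front. *)
Lemma dual_chain_moves n lam mu g : dual_chain r n lam mu g ->
  exists2 qs, [/\ size qs = n, sorted ltn qs, movable r (nth 0 mu) qs &
                  nth 0 lam =1 moves r (nth 0 mu) qs] &
    (\prod_(i < n) ribbon_sgn (layer g i) = (-1) ^+ jumps r (nth 0 mu) qs)%R /\
    (forall q qs', qs = q :: qs' -> left_col (layer g 0) = (nth 0 mu q).+1).
Proof.
elim: n mu g => [|n IH] mu g [sg g0 gn /allP pg [lg cg]].
  exists [::]; first by split=> // i; rewrite -gn -g0.
  by split; rewrite // big_ord0.
case: g sg g0 gn pg lg cg => [//|mu' [//|nu g]] /= [sg] e gn pg lg cg;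
  subst mu'.
have part_mu : is_part mu by apply: pg; rewrite mem_head.
have part_nu : is_part nu by apply: pg; rewrite !inE eqxx orbT.
have [qs [sq srt mv lamE] [sgnE leftE]] : exists2 qs,
    [/\ size qs = n, sorted ltn qs, movable r (nth 0 nu) qs &
        nth 0 lam =1 moves r (nth 0 nu) qs] &
    (\prod_(i < n) ribbon_sgn (layer (nu :: g) i)
       = (-1) ^+ jumps r (nth 0 nu) qs)%R /\
    (forall q qs', qs = q :: qs' ->
       left_col (layer (nu :: g) 0) = (nth 0 nu q).+1).
  apply: IH; split=> //; first by rewrite -sg.
    by apply/allP => x xg; apply: pg; rewrite inE xg orbT.
  by split=> i hi; [exact: (lg i.+1)|exact: (cg i.+1)].
have [sub rib] := lg 0 isT.
have [q unb nuE] := ribbon_is_move r_gt0 part_mu part_nu sub rib.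
have E : bead_move r (nth 0 mu) q = nth 0 nu by apply/funext.
have fdec := part_decreasing part_mu; have gdec := part_decreasing part_nu.
exists (q :: qs); rewrite /= ?E; last split.
- split=> //; first by rewrite /= sq.
    case: qs sq srt leftE {mv lamE sgnE} => [//|q' qs] /= [sq] srt leftE.
    rewrite srt andbT.
    have : left_col (layer (nu :: g) 0) <= left_col (layer [:: mu, nu & g] 0).
      by apply: (cg 0); rewrite ltnS -sq.
    rewrite (leftE _ _ erefl) (move_left_col r_gt0 part_mu unb nuE).
    (* If [q' <= q], row [q'] of [nu] is at least as long as row [q] of [nu], which exceeds
       [nth 0 mu q]; this contradicts the order of the left columns. *)
    rewrite ltnS => h; rewrite ltnNge; apply/negP => qq.
    have := decreasing_le gdec qq; have := move_ge r_gt0 q fdec unb.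
    by rewrite E leqnn landing_le; lia.
  by rewrite unb.
- rewrite big_ord_recl exprD -sgnE; congr (_ * _)%R.
  exact: move_ribbon_sgn.
- by move=> q' qs' [<- _]; exact: (move_left_col r_gt0 part_mu unb nuE).
Qed.

Lemma moves_dual_chain lam mu qs : is_part mu -> is_part lam ->
  sorted ltn qs -> movable r (nth 0 mu) qs ->
  nth 0 lam =1 moves r (nth 0 mu) qs ->
  dual_polyribbon r (size qs) lam mu.
Proof.
move=> part_mu part_lam srt mv lamE.
suff [g ? _] : exists2 g, dual_chain r (size qs) lam mu g &
   (forall q qs', qs = q :: qs' -> left_col (layer g 0) = (nth 0 mu q).+1).
  by exists g.
elim: qs mu part_mu srt mv lamE => [|q qs IH] mu part_mu srt mv lamE.
  exists [:: mu] => //; split=> //=; last by rewrite part_mu.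
  by apply: part_ext => // i; rewrite lamE.
have fdec := part_decreasing part_mu.
move: mv lamE => /= /andP[unb mv] lamE.
(* From row [size mu + q.+1] on, all rows are empty before and after the move, so [strip] loses
   nothing. *)
have [part_nu nuE] : is_part (strip (size mu + q.+1) (bead_move r (nth 0 mu)
  q)) /\
    nth 0 (strip (size mu + q.+1) (bead_move r (nth 0 mu) q)) =1
      bead_move r (nth 0 mu) q.
  apply: stripP; first exact: move_decreasing.
  by move=> i hi; rewrite move_gt ?nth_default//; lia.
move: (strip _ _) part_nu nuE => nu part_nu nuE.
have E : bead_move r (nth 0 mu) q = nth 0 nu by apply/funext.
rewrite E in mv lamE.
have [g [sg g0 gn pg [lg cg]] leftE] := IH nu part_nu (path_sorted srt) mv lamE.
have left0 : left_col (Defs.skew nu mu) = (nth 0 mu q).+1.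
  exact: (move_left_col r_gt0 part_mu unb nuE).
exists (mu :: g); last first.
  by move=> q' qs' [<- _]; rewrite /layer /= g0.
split=> //=; [by rewrite sg|by rewrite part_mu|].
split=> -[|i] hi.
- rewrite /layer /= g0; split.
    exact: (move_dg_sub r_gt0 part_mu unb nuE).
  exact: (move_ribbon r_gt0 part_mu unb nuE).
- exact: lg.
- rewrite {2}/layer /= g0 left0.
  case: qs srt hi leftE {IH mv lamE sg gn lg cg} => [//|q' qs] /= /andP[qq _] _
    leftE.
  rewrite (leftE _ _ erefl) ltnS nuE move_gt//.
  exact/(decreasing_le fdec)/ltnW.
- exact: cg.
Qed.

Lemma dual_polyribbon_part n lam mu : dual_polyribbon r n lam mu ->
  is_part lam /\ is_part mu.
Proof.
move=> [g [sg <- <- /allP pg _]].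
by split; apply: pg; apply: mem_nth; rewrite sg.
Qed.

(** [the_chain] is an arbitrary choice, but every chain comes from moves with the same result, and
    [moves_inj] makes these unique. *)
Lemma sgn_dualE n lam mu qs : dual_polyribbon r n lam mu ->
  sorted ltn qs -> movable r (nth 0 mu) qs ->
  nth 0 lam =1 moves r (nth 0 mu) qs ->
  n = size qs /\ (sgn_dual r lam mu = (-1) ^+ jumps r (nth 0 mu) qs)%R.
Proof.
move=> dp srt mv lamE.
have [_ /part_decreasing fdec] := dual_polyribbon_part dp.
have uniq_qs qs' : sorted ltn qs' -> movable r (nth 0 mu) qs' ->
    nth 0 lam =1 moves r (nth 0 mu) qs' -> qs' = qs.
  move=> srt' mv' lamE'; apply: (moves_inj r_gt0 fdec) => // i.
  by rewrite -lamE' lamE.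
split.
  have [g /dual_chain_moves[qs' [<- srt' mv' lamE'] _]] := dp.
  by rewrite (uniq_qs qs').
have [n' dc] : [set g | exists n, dual_chain r n lam mu g]%classic (the_chain r
  lam mu).
  by apply: xgetPex; have [g dc] := dp; exists g, n.
rewrite /sgn_dual; have [-> _ _ _ _] := dc.
have [qs' [_ srt' mv' lamE'] [-> _]] := dual_chain_moves dc.
by rewrite (uniq_qs qs').
Qed.

(** The bound on [q] tells how many variables suffice: a partition has at most as many rows as
    boxes. *)
Lemma dual_polyribbon_moves n lam mu : dual_polyribbon r n lam mu ->
  exists qs, [/\ size qs = n, sorted ltn qs, movable r (nth 0 mu) qs,
                 nth 0 lam =1 moves r (nth 0 mu) qs &
                 forall q, q \in qs -> q < #|` dg mu| + n * r].
Proof.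
move=> dp; have [part_lam /part_decreasing fdec] := dual_polyribbon_part dp.
have [g /dual_chain_moves[qs [sq srt mv lamE] _]] := dp; exists qs;
  split=> // q qqs.
apply: leq_trans (dg_dual_polyribbon dp).
apply: leq_trans (size_dg _); last by case/andP: part_lam.
by rewrite -part_nth_gt0// lamE moves_row_gt0.
Qed.

End Chains.

(** * Schur functions in finitely many variables *)

Section SeriesBasics.
Local Open Scope ring_scope.
Implicit Types (f g h : series) (m a : monom).

Definition mono a : series := fun m => (m == a)%:R.
Definition variable (v : nat * nat) : series := mono [mset v]%mset.

Lemma sum_seriesE I (s : seq I) (P : pred I) (F : I -> series) m :
  (\sum_(i <- s | P i) F i) m = \sum_(i <- s | P i) F i m.
Proof. by apply: (big_morph (fun f : series => f m)). Qed.

Lemma mmulI a m m' : mmul a m = mmul a m' -> m = m'.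
Proof.
move=> e; apply/msetP => v; have := congr1 (fun x : monom => x v) e.
by rewrite !mmulE => /addnI.
Qed.

Lemma mono_mulE a f m : (mono a * f) (mmul a m) = f m.
Proof.
rewrite [LHS](smulE _ _ (fsubset_refl _)) exchange_big /=.
have /andP[aD mD] := mmul_divs (erefl (mmul a m)).
transitivity (\sum_(b <- divs (mmul a m)) (m == b)%:R * f b).
  apply: eq_bigr => b _.
  rewrite (eq_bigr (fun c => (a == c)%:R * ((mmul c b == mmul a m)%:R * f b))).
    rewrite (sum_pick (F := fun c => (mmul c b == mmul a m)%:R * _));
      last first.
      by rewrite aD.
    congr (_%:R * _); congr (nat_of_bool _).
    by apply/eqP/eqP => [/mmulI ->|->].
  by move=> c _; rewrite /mono [c == _]eq_sym mulrCA.
by rewrite sum_pick// mD.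
Qed.

Lemma mono_mul0 a f m v : (m v < a v)%N -> (mono a * f) m = 0.
Proof.
move=> ma; rewrite [LHS](smulE _ _ (fsubset_refl _)) big_seq big1// => c cD.
apply: big1 => b _; rewrite /mono; case: eqP => [_|]; last by rewrite mul0r.
case: eqP => [e|]; last by rewrite mul0r mulr0.
by move: cD => /mem_divs /(_ v); rewrite e leqNgt ma.
Qed.

Lemma mono0 : mono mone = 1.
Proof. by []. Qed.

Lemma monoM a b : mono a * mono b = mono (mmul a b).
Proof.
apply/funext => m; have [|] := pselect (forall v, a v <= m v)%N.
  move=> am; have -> : m = mmul a (msetB m a).
    by apply/msetP => v; rewrite mmulE msetE2 subnKC.
  rewrite mono_mulE /mono; congr (nat_of_bool _)%:R.
  by apply/eqP/eqP => [->|/mmulI].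
move=> /existsNP[v /negP]; rewrite -ltnNge => ma.
rewrite (mono_mul0 _ ma) /mono; case: eqP => // e; move: ma.
by rewrite e mmulE ltnNge leq_addr.
Qed.

Lemma mono_seq (s : seq (nat * nat)) :
  mono (seq_mset s) = \prod_(v <- s) variable v.
Proof.
elim: s => [|v s IH].
  rewrite big_nil -mono0; congr mono; apply/msetP => v.
  by rewrite mset_seqE mset0E.
rewrite big_cons -IH monoM; congr mono; apply/msetP => w.
by rewrite mmulE !mset_seqE msetnE /= eq_sym; case: eqP.
Qed.

(** If [variable v * h = variable w * h], the coefficient of [h] at [m] is unchanged when a factor
    [w] of [m] is replaced by [v]. When no [w] is left, the coefficient is 0. *)
Lemma variable_sub_lreg v w : v != w -> GRing.lreg (variable v - variable w).
Proof.
move=> vw f g /eqP; rewrite -subr_eq0 -mulrBr => /eqP; rewrite mulrBl.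
move=> /eqP; rewrite subr_eq0 => /eqP e.
apply/eqP; rewrite -subr_eq0; apply/eqP; move: (f - g) e => h e.
apply/funext => m; move: {2}(m w) (erefl (m w)) => n.
elim: n m => [|n IH] m mw; rewrite -(mono_mulE [mset v]%mset) [X in X _ = _]e.
  by apply: (@mono_mul0 _ _ _ w);
    rewrite mmulE mw !msetnE eqxx eq_sym (negbTE vw).
have mE : m = mmul [mset w]%mset (msetB m [mset w]%mset).
  apply/msetP => x; rewrite mmulE msetE2 msetnE.
  by have [->|_] := eqVneq x w; [rewrite mw subnKC|rewrite subn0].
rewrite mE mmulA [mmul [mset v]%mset _]mmulC -mmulA mono_mulE.
apply: IH; rewrite mmulE msetE2 mw !msetnE eqxx eq_sym (negbTE vw).
by rewrite subn1.
Qed.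

Lemma vandermonde_lreg k N :
  GRing.lreg (vandermonde (fun j => variable (k, j)) N).
Proof.
rewrite /vandermonde; apply: big_ind => [|x y|j _];
  [exact: lreg1|exact: lregM|].
apply: big_ind => [|x y|i _]; [exact: lreg1|exact: lregM|].
by apply: variable_sub_lreg; rewrite xpair_eqE eqxx /= ltn_eqF.
Qed.

Definition bounded_vars (N : nat) m := forall v, v \in m -> (v.2 < N)%N.

(* Equality after setting to 0 the [x_{k,j}] with [j > N]. *)
Definition agree (N : nat) f g := forall m, bounded_vars N m -> f m = g m.

(** A divisor of a monomial in the first variables involves only these variables. *)
Lemma agreeM N f g f' g' : agree N f f' -> agree N g g' ->
  agree N (f * g) (f' * g').
Proof.
move=> ff gg m mN.
rewrite [LHS](smulE _ _ (fsubset_refl _)) [RHS](smulE _ _ (fsubset_refl _)).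
have dN c : c \in divs m -> bounded_vars N c.
  move=> /mem_divs cm v vc; apply: mN; rewrite -mset_gt0.
  by apply: leq_trans (cm v); rewrite mset_gt0.
rewrite big_seq [RHS]big_seq; apply: eq_bigr => a /dN aN.
rewrite big_seq [RHS]big_seq; apply: eq_bigr => b /dN bN.
by rewrite ff// gg.
Qed.

Lemma agree_prod N I (s : seq I) (F G : I -> series) :
  (forall i, agree N (F i) (G i)) ->
  agree N (\prod_(i <- s) F i) (\prod_(i <- s) G i).
Proof.
move=> FG; elim: s => [|i s IH]; first by rewrite !big_nil.
by rewrite !big_cons; exact: agreeM.
Qed.

End SeriesBasics.

(** * Semistandard tableaux built letter by letter *)

Section Tableaux.
Implicit Types (f : nat -> nat) (t : seq (seq nat)).

(** Fills the horizontal strip of the new largest letter [N], in [N] old rows and one new row. *)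
Definition extend N f t : seq (seq nat) :=
  mkseq (fun i => nth [::] t i ++ nseq (f i - size (nth [::] t i)) N) N.+1.

Lemma size_extend N f t : size (extend N f t) = N.+1.
Proof. exact: size_mkseq. Qed.

Lemma nth_extend N f t i : i <= N -> nth [::] (extend N f t) i =
  nth [::] t i ++ nseq (f i - size (nth [::] t i)) N.
Proof. by move=> iN; rewrite nth_mkseq. Qed.

Arguments extend : simpl never.

Fixpoint ssyts N f : seq (seq (seq nat)) :=
  if N is N'.+1 then
    [seq extend N' f t | mu <- interlacings N' f, t <- ssyts N' (nth 0 mu)]
  else [:: [::]].

Lemma sorted_filter_lt N (s : seq nat) :
  sorted leq s -> {in s, forall x, x <= N} ->
  s = [seq x <- s | x < N] ++ nseq (size s - size [seq x <- s | x < N]) N.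
Proof.
elim: s => //= x s IH xs sN.
have {}IH := IH (path_sorted xs) (fun y ys => sN y (mem_behead (s := x :: s)
  ys)).
case: ltnP => [xN|Nx] /=; first by rewrite subSS -IH.
have xE : x = N by apply/eqP; rewrite eqn_leq Nx sN ?mem_head.
have -> : [seq y <- s | y < N] = [::].
  apply/eqP; rewrite -[_ == _]negbK -has_filter; apply/hasPn => y ys.
  have /allP/(_ y ys) := order_path_min leq_trans xs.
  by rewrite -leqNgt xE.
rewrite subn0 /= xE; congr (_ :: _); apply/all_pred1P/allP => y ys /=.
have /allP/(_ y ys) /= := order_path_min leq_trans xs.
by have := sN y; rewrite inE ys orbT => /(_ isT); rewrite xE; lia.
Qed.

(** The form of [is_ssyt] suited to the recursion: exactly [N] rows, some possibly empty, and
    letters below [N]. *)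
Definition tableau N f t : Prop :=
  [/\ size t = N, (forall i, i < N -> size (nth [::] t i) = f i),
      (forall i, i < N -> sorted leq (nth [::] t i)),
      (forall i j, i.+1 < N -> j < f i.+1 ->
         nth 0 (nth [::] t i) j < nth 0 (nth [::] t i.+1) j) &
      (forall i j, i < N -> j < f i -> nth 0 (nth [::] t i) j < N)].

Lemma interlacings_decreasing N f mu : decreasing f ->
  mu \in interlacings N f -> decreasing (nth 0 mu).
Proof.
move=> fdec /interlacingsP[//|smu muP] i.
have [iN|Ni] := ltnP i.+1 N; last by rewrite nth_default// smu.
by have := muP i; have := muP i.+1; lia.
Qed.

(** The interlacing condition [f i.+1 <= nth 0 mu i] keeps two letters [N] out of the same
    column. *)
Lemma ssyts_tableau N f t : decreasing f -> t \in ssyts N f -> tableau N f t.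
Proof.
elim: N f t => [|N IH] f t fdec /=; first by rewrite inE => /eqP ->; split.
case/allpairsPdep => mu [t' [muI + ->]].
have mudec := interlacings_decreasing fdec muI.
have /interlacingsP[//|smu muP] := muI.
move=> /(IH _ _ mudec)[st' rowt' srtt' colt' ltt'].
have row0 : nth [::] t' N = [::] by rewrite nth_default// st'.
have szt' i : i <= N -> size (nth [::] t' i) = nth 0 mu i.
  rewrite leq_eqVlt => /predU1P[->|/rowt'//].
  by rewrite row0 nth_default ?smu.
have rowE i : i <= N -> nth [::] (extend N f t') i =
    nth [::] t' i ++ nseq (f i - nth 0 mu i) N.
  by move=> iN; rewrite nth_mkseq ?ltnS// szt'.
have mule i : i <= N -> nth 0 mu i <= f i.
  rewrite leq_eqVlt => /predU1P[->|iN]; first by rewrite nth_default ?smu.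
  by have := muP i iN; lia.
have srt' i : i <= N -> sorted leq (nth [::] t' i).
  by rewrite leq_eqVlt => /predU1P[->|/srtt'//]; rewrite row0.
have lt_mu i j : j < nth 0 mu i -> i < N.
  by move=> jmu; rewrite ltnNge; apply/negP => Ni;
    rewrite nth_default ?smu in jmu.
have entry i j : i <= N -> j < f i -> nth 0 (nth [::] (extend N f t') i) j =
    if j < nth 0 mu i then nth 0 (nth [::] t' i) j else N.
  move=> iN jf; rewrite rowE// nth_cat szt'//; case: ifP => // /negbT.
  by rewrite -leqNgt => h; rewrite nth_nseq ifT//; lia.
have rsz i : i <= N -> size (nth [::] (extend N f t') i) = f i.
  by move=> iN; rewrite rowE// size_cat size_nseq szt'// subnKC// mule.
split=> [|i|i|i j|i j]; rewrite ?size_mkseq ?ltnS//.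
- exact: rsz.
- move=> iN; apply/(sortedP 0) => j; rewrite rsz// => jf.
  rewrite !entry ?(ltnW jf)//.
  case: (ltnP j (nth 0 mu i)) => jmu; case: (ltnP j.+1 (nth 0 mu i)) => jmu1 //.
  + by move: (srt' i iN) => /(sortedP 0) h; apply: h; rewrite szt'.
  + by apply/ltnW/ltt' => //; exact: lt_mu jmu.
  + lia.
- move=> iN jf; have jmu : j < nth 0 mu i by have := muP i iN; lia.
  have jf' : j < f i by apply: leq_trans jf (fdec i).
  rewrite !entry ?(ltnW iN)// jmu; case: ifP => [jmu'|_].
    by apply: colt' => //; exact: lt_mu jmu'.
  exact: ltt'.
- move=> iN jf; rewrite entry//; case: ifP => // jmu.
  by apply/ltnW/ltt'; [exact: lt_mu jmu|].
Qed.

Lemma tableau_entry_ge N f t i j : decreasing f -> tableau N f t ->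
  i < N -> j < f i -> i <= nth 0 (nth [::] t i) j.
Proof.
move=> fdec [_ _ _ col _]; elim: i => // i IH iN jf.
apply: leq_ltn_trans (col i j iN jf); apply: IH; first exact: ltnW.
exact: leq_trans jf (fdec i).
Qed.

(** Erasing the letter [N] inverts [extend]; the lengths of the remaining rows form the interlacing
    [mu]. *)
Lemma tableau_ssyts N f t : decreasing f -> tableau N f t -> t \in ssyts N f.
Proof.
elim: N f t => [|N IH] f t fdec tab;
  first by have [/size0nil -> _ _ _ _] := tab.
have [st szt srt col ltt] := tab.
pose low i := [seq x <- nth [::] t i | x < N].
have rowE i : i <= N -> nth [::] t i = low i ++ nseq (f i - size (low i)) N.
  move=> iN; rewrite {1}(@sorted_filter_lt N (nth [::] t i)) ?szt//;
    first exact: srt.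
  by move=> x /(nthP 0)[j]; rewrite szt// => jf <-; rewrite -ltnS; exact: ltt.
have low_le i : i <= N -> size (low i) <= f i.
  by move=> iN; rewrite -szt// size_filter count_size.
have entry i j : i <= N -> j < f i -> nth 0 (nth [::] t i) j =
    if j < size (low i) then nth 0 (low i) j else N.
  move=> iN jf; rewrite {1}rowE// nth_cat; case: ifP => // /negbT.
  by rewrite -leqNgt => h; rewrite nth_nseq ifT//; lia.
have low_lt i j : j < size (low i) -> nth 0 (low i) j < N.
  by move=> /(mem_nth 0); rewrite mem_filter => /andP[].
(* Otherwise a letter [N] in row [i] would have a box below it, with a letter larger than [N]. *)
have low_ge i : i < N -> f i.+1 <= size (low i).
  move=> iN; rewrite leqNgt; apply/negP => h.
  have jf : size (low i) < f i by apply: leq_trans h (fdec i).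
  have := col i _ iN h; rewrite entry ?(ltnW iN)// ltnn.
  by have := ltt i.+1 _ iN h; lia.
(* By column strictness the entries of row [N] are at least [N]. *)
have lowN : low N = [::].
  apply: size0nil; apply/eqP; rewrite -leqn0 leqNgt; apply/negP => h.
  have := low_lt N 0 h; rewrite ltnNge;
    have := entry N 0 (leqnn N) (leq_trans h (low_le N (leqnn N))).
  by rewrite h => <-; rewrite (tableau_entry_ge fdec tab)// (leq_trans h)//
    low_le.
pose mu := mkseq (fun i => size (low i)) N.
have muE i : i < N -> nth 0 mu i = size (low i) by move=> iN; rewrite nth_mkseq.
have mudec : decreasing (nth 0 mu).
  move=> i; have [iN|Ni] := ltnP i.+1 N;
    last by rewrite nth_default// size_mkseq.
  by rewrite !muE ?(ltnW iN)//;
    apply: leq_trans (low_le _ (ltnW iN)) (low_ge _ (ltnW iN)).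
rewrite /=; apply/allpairsPdep; exists mu, (mkseq low N); split.
- apply/interlacingsP => //; rewrite size_mkseq; split=> // i iN.
  by rewrite muE// low_ge// low_le// ltnW.
- apply: IH => //; split=> [|i iN|i iN|i j iN|i j iN].
  + by rewrite size_mkseq.
  + by rewrite nth_mkseq// muE.
  + by rewrite nth_mkseq//; apply: sorted_filter;
    [exact: leq_trans|apply: srt; exact: ltnW].
  + rewrite muE// !nth_mkseq ?(ltnW iN)// => jlow.
    have jf : j < f i.+1 by apply: leq_trans jlow (low_le _ (ltnW iN)).
    have := col i j (ltnW iN) jf; rewrite !entry ?(ltnW iN) ?(ltnW (ltnW iN))//.
      by rewrite jlow ifT//; apply: leq_trans jf (low_ge _ (ltnW iN)).
    exact: leq_trans jf (fdec i).
  + by rewrite muE// nth_mkseq//; exact: low_lt.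
- apply: (@eq_from_nth _ [::]); rewrite ?size_mkseq// st => i iN.
  rewrite nth_mkseq// rowE//.
  have [iN'|] := ltnP i N; first by rewrite nth_mkseq.
  move: iN; rewrite ltnS => iN Ni; have -> : i = N by apply/eqP;
    rewrite eqn_leq iN.
  by rewrite lowN nth_default// size_mkseq.
Qed.

Lemma extend_inj N f t t' : size t = N -> size t' = N ->
  (forall i j, i < N -> j < size (nth [::] t i) -> nth 0 (nth [::] t i) j < N)
    ->
  (forall i j, i < N -> j < size (nth [::] t' i) -> nth 0 (nth [::] t' i) j <
    N) ->
  extend N f t = extend N f t' -> t = t'.
Proof.
have key u i : (forall i j, i < N -> j < size (nth [::] u i) -> nth 0 (nth [::]
  u i) j < N) ->
    i < N -> nth [::] u i = [seq x <- nth [::] (extend N f u) i | x < N].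
  move=> ult iN; rewrite nth_mkseq ?ltnS ?(ltnW iN)//= filter_cat.
  rewrite [X in _ ++ X](_ : _ = [::]) ?cats0.
    by rewrite -[LHS]filter_predT;
      apply: eq_in_filter => x /(nthP 0)[j js <-]; rewrite ult.
  by apply/eqP; rewrite -[_ == _]negbK -has_filter has_nseq ltnn andbF.
move=> st st' tl tl' e; apply: (@eq_from_nth _ [::]); rewrite st// => i iN.
by rewrite (key t)// (key t')// e.
Qed.

Lemma ssyts_uniq N f : decreasing f -> uniq (ssyts N f).
Proof.
elim: N f => //= N IH f fdec.
have mudec mu (muI : mu \in interlacings N f) := interlacings_decreasing fdec
  muI.
apply: allpairs_uniq_dep.
- apply: cart_uniq; apply/allP => _ /mapP[i _ ->]; exact: iota_uniq.
- by move=> mu /mudec; exact: IH.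
move=> _ _ /allpairsPdep[mu [t [muI tI ->]]] /allpairsPdep[mu' [t' [muI' tI'
  ->]]] /= e.
have [st szt _ _ lt] := ssyts_tableau (mudec _ muI) tI.
have [st' szt' _ _ lt'] := ssyts_tableau (mudec _ muI') tI'.
have tt' : t = t'.
  by apply: (extend_inj st st') e => i j iN; rewrite ?szt ?szt'//; auto.
subst t'; suff -> : mu = mu' by [].
move: muI muI' => /interlacingsP[//|smu _] /interlacingsP[//|smu' _].
apply: (@eq_from_nth _ 0); first by rewrite smu.
by rewrite smu => i iN; rewrite -szt// szt'.
Qed.

End Tableaux.

Section SchurPolynomials.
Local Open Scope ring_scope.

Lemma schur_poly_ssyts (R : comNzRingType) (x : nat -> R) N f : decreasing f ->
  schur_poly x N f = \sum_(t <- ssyts N f) \prod_(j <- flatten t) x j.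
Proof.
elim: N f => [|N IH] f fdec; first by rewrite big_seq1 big_nil.
rewrite [RHS]big_allpairs_dep [LHS]/=; apply: eq_big_seq => mu muI.
have mudec := interlacings_decreasing fdec muI.
have /interlacingsP[//|smu _] := muI.
rewrite IH// mulr_suml;
  apply: eq_big_seq => t /(ssyts_tableau mudec)[st szt _ _ _].
rewrite !big_flatten [in RHS](big_nth [::]) size_extend big_mkord -prodrXr.
rewrite (big_nth [::]) st big_mkord.
rewrite [in RHS]big_ord_recr [X in _ * X = _]big_ord_recr /= mulrA.
rewrite nth_extend// !(@nth_default _ _ _ N) ?st ?smu// !subn0.
rewrite big_nseq iter_mulr_1; congr (_ * _).
rewrite -big_split; apply: eq_bigr => i _ /=.
rewrite nth_extend; last exact/ltnW/ltn_ord.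
by rewrite big_cat big_nseq iter_mulr_1 szt.
Qed.

Lemma tableauP N f t : decreasing f ->
  (is_ssyt (mkseq f N) t /\ forall j, j \in flatten t -> (j < N)%N)
  <-> tableau N f t.
Proof.
move=> fdec; split.
  move=> [[sh /all_nthP srt col] lt].
  have st : size t = N by rewrite -(size_map size t) -/(shape t) sh size_mkseq.
  have szt i : (i < N)%N -> size (nth [::] t i) = f i.
    by move=> iN; rewrite -(nth_mkseq 0%N f iN) -sh (nth_map [::]) ?st.
  split=> // [i iN|i j iN jf|i j iN jf].
  - by apply: srt; rewrite st.
  - by apply: col; rewrite ?st ?szt.
  - apply: lt; apply/flattenP; exists (nth [::] t i); apply: mem_nth.
      by rewrite st.
    by rewrite szt.
move=> [st szt srt col lt]; split; last first.
  move=> j /flattenP[row /(nthP [::])[i]]; rewrite st => iN <- /(nthP 0%N)[k].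
  by rewrite szt// => kf <-; exact: lt.
split.
- apply: (@eq_from_nth _ 0%N); first by rewrite size_map size_mkseq.
  by rewrite size_map st => i iN; rewrite (nth_map [::]) ?st// nth_mkseq// szt.
- by apply/(all_nthP [::]) => i; rewrite st; exact: srt.
- move=> i j; rewrite st => iN; rewrite szt// => jf; exact: col.
Qed.

Lemma schur_agree k N f : decreasing f ->
  agree N (schur k.+1 (mkseq f N)) (schur_poly (fun j => variable (k, j)) N f).
Proof.
move=> fdec m mN; rewrite schur_poly_ssyts// sum_seriesE /schur.
pose L := [seq t <- ssyts N f | ssyt_monom k.+1 t == m].
rewrite (_ : [set t | _]%classic = [set` L]%classic); last first.
  apply/seteqP; split=> t /=; rewrite mem_filter.
    move=> [ss tm]; rewrite tm eqxx /=; apply: tableau_ssyts => //.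
    apply/tableauP => //; split=> // j jt; apply: (mN (k, j)).
    rewrite -tm /ssyt_monom (perm_mem (perm_eq_seq_mset _)).
    by apply: map_f.
  by move=> /andP[/eqP tm /(ssyts_tableau fdec)/(tableauP _ _ fdec)[]].
rewrite -fsbig_seq; last exact/filter_uniq/ssyts_uniq.
rewrite big_filter big_mkcond /=; apply: eq_bigr => t _.
rewrite -(big_map (fun j => (k, j)) xpredT (fun v => variable v)) -mono_seq.
by rewrite /mono eq_sym /ssyt_monom; case: eqP.
Qed.

Lemma catIs (T : eqType) (s s1 s2 : seq T) : s1 ++ s = s2 ++ s -> s1 = s2.
Proof.
move=> e; have /eqP := congr1 size e; rewrite !size_cat eqn_add2r => /eqP ss.
by move/eqP: e; rewrite eqseq_cat// => /andP[/eqP].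
Qed.

(** The alternants work with exactly [N] rows; adding empty rows is a bijection on tableaux that
    preserves the monomial. *)
Lemma schur_pad k lam c : schur k (lam ++ nseq c 0%N) = schur k lam.
Proof.
apply/funext => m; rewrite /schur.
have fl t : flatten (t ++ nseq c [::]) = flatten t :> seq nat.
  rewrite flatten_cat; apply/eqP;
    rewrite -[X in _ == X]cats0 eqseq_cat// eqxx /=.
  by elim: c.
have pad_nth (t : seq (seq nat)) i :
    nth [::] (t ++ nseq c [::]) i = nth [::] t i.
  rewrite nth_cat; case: ltnP => // ti.
  by rewrite nth_nseq if_same nth_default.
apply: (reindex_fsbig (fun t : seq (seq nat) => t ++ nseq c [::])).
split.
- move=> t /= [[sh srt col] tm]; split; last by rewrite /ssyt_monom fl.
  split.
  + by rewrite /shape map_cat map_nseq -sh.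
  + by rewrite all_cat srt all_nseq orbT.
  + move=> i j; rewrite !pad_nth => _ jt; apply: col => //.
    by rewrite ltnNge; apply/negP => ti; rewrite nth_default in jt.
- by move=> t t' _ _ /catIs.
move=> t /= [[sh srt col] tm].
pose u := take (size lam) t.
have tE : t = u ++ nseq c [::].
  rewrite -[LHS](cat_take_drop (size lam)) -/u; congr (_ ++ _).
  have shd : shape (drop (size lam) t) = nseq c 0%N.
    by rewrite /shape map_drop -/(shape t) sh drop_size_cat.
  have sd : size (drop (size lam) t) = c by rewrite -(size_map size) -/(shape
    _) shd size_nseq.
  rewrite -sd; apply/all_pred1P/allP => s /(map_f size);
    rewrite -/(shape _) shd.
  by move=> /nseqP[/size0nil ->].
exists u => //; split; last by rewrite -tm /ssyt_monom [in RHS]tE fl.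
rewrite tE in sh srt col; split.
- by move: sh; rewrite /shape map_cat map_nseq => /catIs.
- by move: srt; rewrite all_cat => /andP[].
- move=> i j iu ju; have := col i j; rewrite !pad_nth; apply=> //.
  by rewrite size_cat (leq_trans iu)// leq_addr.
Qed.

Lemma schur_part_agree k N lam : is_part lam -> (size lam <= N)%N ->
  agree N (schur k.+1 lam)
    (schur_poly (fun j => variable (k, j)) N (nth 0%N lam)).
Proof.
move=> pl lN; have <- : schur k.+1 (mkseq (nth 0%N lam) N) = schur k.+1 lam.
  rewrite -(schur_pad k.+1 lam (N - size lam)); congr schur.
  apply: (@eq_from_nth _ 0%N);
    first by rewrite size_mkseq size_cat size_nseq subnKC.
  rewrite size_mkseq => i iN; rewrite nth_mkseq// nth_cat; case: ltnP => // li.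
  by rewrite nth_nseq if_same nth_default.
exact/schur_agree/part_decreasing.
Qed.

Lemma schur_nil k : schur k [::] = 1.
Proof.
apply/funext => m; rewrite /schur.
have [->|m0] := eqVneq m mone.
  rewrite (_ : [set t | _]%classic = [set [::]]%classic) ?fsbig_set1.
    by rewrite -mono0 /mono eqxx.
  apply/seteqP; split=> t /=; first by move=> [[/(congr1 size)]];
    rewrite size_map => /size0nil.
  by move=> ->; split=> //; apply/msetP => v; rewrite mset_seqE mset0E.
rewrite (_ : [set t | _]%classic = set0%classic) ?fsbig_set0.
  by rewrite -mono0 /mono (negbTE m0).
apply/seteqP; split=> t //= [[/(congr1 size)]];
  rewrite size_map => /size0nil -> _ _.
move=> e; move: m0; rewrite -e => /eqP; apply.
by apply/msetP => v; rewrite mset_seqE mset0E.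
Qed.

End SchurPolynomials.

(** * Power substitutions of the square-free series *)

Section SquareFree.
Local Open Scope ring_scope.

(* [E^+_d] is the case [u = 1] and [E_d] the case [u = -1]. *)
Definition Esigned (u : rat) (d : nat) : series := fun m =>
  if uniq m && (mdegree m == d) then u ^+ size m else 0.

Lemma mpowE r m v : mpow r m v = (r * m v)%N.
Proof.
rewrite /mpow fsfun_fun; case: finsuppP => // _.
by rewrite muln0.
Qed.

Lemma mpow_inj r : (0 < r)%N -> injective (mpow r).
Proof.
move=> r0 m m' e; apply/msetP => v.
have := congr1 (fun x : monom => x v) e; rewrite !mpowE => /eqP.
by rewrite eqn_pmul2l// => /eqP.
Qed.

Lemma monoX r a : mono a ^+ r = mono (mpow r a).
Proof.
elim: r => [|r IH]; rewrite ?expr0 ?exprS ?IH ?monoM -?mono0; congr mono.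
  by apply/msetP => v; rewrite mpowE mset0E.
by apply/msetP => v; rewrite mmulE !mpowE mulSn.
Qed.

Section Families.
Variables K N : nat.
Implicit Types S : {ffun 'I_K -> {set 'I_N}}.

(* [S] stands for the square-free monomial in the [(k, j)] with [j] in [S k]. *)
Definition family_vars S : seq (nat * nat) :=
  [seq (nat_of_ord k, nat_of_ord j) | k <- enum 'I_K, j <- enum (S k)].
Definition family_size S : nat := (\sum_k #|S k|)%N.
Definition family_degree S : nat := (\sum_(k < K) k.+1 * #|S k|)%N.
Definition family_monom S : monom := seq_mset (family_vars S).

Lemma mem_family_vars S (k : 'I_K) (j : 'I_N) :
  ((k : nat, j : nat) \in family_vars S) = (j \in S k).
Proof.
apply/allpairsPdep/idP => [[k' [j' [_ + [/ord_inj -> /ord_inj ->]]]]|jS].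
  by rewrite mem_enum.
by exists k, j; rewrite !mem_enum.
Qed.

Lemma family_vars_uniq S : uniq (family_vars S).
Proof.
apply: allpairs_uniq_dep; [exact: enum_uniq|by move=> *; exact: enum_uniq|].
move=> [k j] [k' j'] _ _ /= [/ord_inj kk]; subst k'.
by move=> /ord_inj ->.
Qed.

Lemma big_family_vars (R : Type) (idx : R) (op : Monoid.com_law idx) S
    (F : nat * nat -> R) :
  \big[op/idx]_(v <- family_vars S) F v =
  \big[op/idx]_k \big[op/idx]_(j in S k) F (k : nat, j : nat).
Proof.
rewrite big_allpairs_dep big_enum /=; apply: eq_bigr => k _.
by rewrite big_enum.
Qed.

Lemma mem_family_monom S v : (v \in family_monom S) = (v \in family_vars S).
Proof. exact/perm_mem/perm_eq_seq_mset. Qed.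

Lemma family_monom_uniq S : uniq (family_monom S).
Proof. by rewrite (perm_uniq (perm_eq_seq_mset _)) family_vars_uniq. Qed.

Lemma size_family_monom S : size (family_monom S) = family_size S.
Proof.
rewrite (perm_size (perm_eq_seq_mset _)) -sum1_size big_family_vars.
by apply: eq_bigr => k _; rewrite sum1_card.
Qed.

Lemma mdegree_family_monom S : mdegree (family_monom S) = family_degree S.
Proof.
rewrite /mdegree (perm_big _ (perm_eq_seq_mset _)) big_family_vars.
by apply: eq_bigr => k _; rewrite /= sum_nat_const mulnC.
Qed.

Lemma family_monom_inj : injective family_monom.
Proof.
move=> S S' e; apply/ffunP => k; apply/setP => j.
by rewrite -!mem_family_vars -!mem_family_monom e.
Qed.

Lemma family_monomX S r :
  \prod_(k < K) \prod_(j in S k) variable (k : nat, j : nat) ^+ r =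
  mono (mpow r (family_monom S)).
Proof.
by rewrite -monoX mono_seq -prodrXl big_family_vars.
Qed.

Lemma family_monom_surj m : bounded_vars N m -> uniq m -> (mdegree m <= K)%N ->
  exists S, m = family_monom S.
Proof.
move=> mN um mK; exists [ffun k : 'I_K => [set j : 'I_N | (k : nat, j : nat)
  \in m]].
set S := finfun _; apply/msetP => v.
rewrite -!count_mem_mset !count_uniq_mem ?family_monom_uniq//;
  congr nat_of_bool.
apply/idP/idP => [vm|]; rewrite mem_family_monom.
  have v1 : (v.1 < K)%N.
    apply: leq_trans mK; rewrite /mdegree (big_rem v vm) /=; exact: leq_addr.
  case: v vm v1 (mN _ vm) => a b vm /= v1 v2.
  have := mem_family_vars S (Ordinal v1) (Ordinal v2) => /= ->.
  by rewrite ffunE inE.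
case/allpairsPdep => k [j [_ + ->]]; rewrite mem_enum ffunE inE.
by [].
Qed.

(** [mpow r] is injective, so each coefficient has at most one term; [d <= K] bounds the degree of
    every variable that can occur. *)
Lemma Esigned_pow_agree u d r : (d <= K)%N -> (0 < r)%N ->
  agree N (subst_pow r (Esigned u d))
    (\sum_(S : {ffun 'I_K -> {set 'I_N}} | family_degree S == d)
       u ^+ family_size S *:
       \prod_(k < K) \prod_(j in S k) variable (k : nat, j : nat) ^+ r).
Proof.
move=> dK r0 m mN; rewrite sum_seriesE.
under eq_bigr do rewrite family_monomX.
transitivity (\sum_(S : {ffun 'I_K -> {set 'I_N}} | family_degree S == d)
    (m == mpow r (family_monom S))%:R * u ^+ family_size S : rat); last first.
  by apply: eq_bigr => S _; rewrite mulrC.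
rewrite /subst_pow; have [[m0 m0E]|no_root] := pselect (exists m0, mpow r m0 =
  m).
  rewrite (_ : [set m' | _]%classic = [set m0]%classic); last first.
    by apply/seteqP; split=> m' /=; [rewrite -m0E => /(mpow_inj r0)|move=> ->].
  rewrite fsbig_set1 -m0E /Esigned.
  have m0N : bounded_vars N m0.
    move=> v; rewrite -mset_gt0 => v0; apply: mN.
    by rewrite -mset_gt0 -m0E mpowE muln_gt0 r0.
  case: ifP => [/andP[um /eqP dm]|nm].
    have [|S m0S] := family_monom_surj m0N um; first by rewrite dm.
    rewrite (bigD1 S) /=; last by rewrite -mdegree_family_monom -m0S dm.
    rewrite -m0S eqxx mul1r -size_family_monom -m0S big1 ?addr0// => S' /andP[_
      ne].
    case: eqP => [/(mpow_inj r0) e|_]; last by rewrite mul0r.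
    by move: ne; rewrite (@family_monom_inj S' S) ?eqxx// -m0S.
  rewrite big1// => S dS; case: eqP => [/(mpow_inj r0) e|_];
    last by rewrite mul0r.
  by move: nm; rewrite e family_monom_uniq mdegree_family_monom dS.
rewrite (_ : [set m' | _]%classic = set0%classic); last first.
  by apply/seteqP; split=> // m' /= m'E; apply: no_root; exists m'.
rewrite fsbig_set0 big1// => S _; case: eqP => [e|_]; last by rewrite mul0r.
by case: no_root; exists (family_monom S).
Qed.

(** [c] sees only the sizes. Once these are fixed, the sum over families is a product of sums over
    single sets, to which [FG] applies. *)
Lemma sum_families_by_size (R : comNzRingType) (c : pred {ffun 'I_K -> nat})
    (F G : 'I_K -> {set 'I_N} -> R) :
  (forall k n, \sum_(A : {set 'I_N} | #|A| == n) F k A =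
               \sum_(A : {set 'I_N} | #|A| == n) G k A) ->
  \sum_(S : {ffun 'I_K -> {set 'I_N}} | c [ffun k => #|S k|])
     \prod_(k < K) F k (S k) =
  \sum_(S : {ffun 'I_K -> {set 'I_N}} | c [ffun k => #|S k|])
     \prod_(k < K) G k (S k).
Proof.
move=> FG.
(* Sizes are taken in ['I_N.+1] so that they range over a finite type. *)
pose sz (S : {ffun 'I_K -> {set 'I_N}}) : {ffun 'I_K -> 'I_N.+1} :=
  [ffun k => inord #|S k|].
have szE S k : sz S k = #|S k| :> nat.
  by rewrite ffunE inordK// ltnS -[X in (_ <= X)%N](card_ord N) max_card.
have key (H : 'I_K -> {set 'I_N} -> R) :
  \sum_(S : {ffun 'I_K -> {set 'I_N}} | c [ffun k => #|S k|])
     \prod_(k < K) H k (S k) =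
  \sum_(n : {ffun 'I_K -> 'I_N.+1} | c [ffun k => n k : nat])
    \prod_(k < K) \sum_(A : {set 'I_N} | #|A| == n k) H k A.
  rewrite (partition_big sz (fun n => c [ffun k => n k : nat])) /=; last first.
    move=> S; congr (is_true (c _)); apply/ffunP => k.
    by rewrite ffunE [RHS]ffunE szE.
  apply: eq_bigr => n cn; rewrite bigA_distr_big_dep.
  apply: eq_bigl => S; apply/idP/familyP => [/andP[_ /eqP <-] k|Sn].
    by rewrite unfold_in szE.
  have Sn' k : #|S k| = n k by have := Sn k; rewrite unfold_in => /eqP.
  apply/andP; split; last first.
    by apply/eqP/ffunP => k; apply: val_inj; rewrite /= szE Sn'.
  suff -> : [ffun k => #|S k|] = [ffun k => n k : nat] by [].
  by apply/ffunP => k; rewrite !ffunE Sn'.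
rewrite !key; apply: eq_bigr => n _; apply: eq_bigr => k _; exact: FG.
Qed.

End Families.
End SquareFree.

(** * Types *)

Section Types.
Implicit Types (tau : seq (nat * nat)) (lam : seq nat).

Lemma block_ge_trans : transitive block_ge.
Proof. by move=> [a b] [c d] [e f]; rewrite /block_ge /=; lia. Qed.

Lemma block_ge_anti : antisymmetric block_ge.
Proof.
move=> [a b] [c d]; rewrite /block_ge /= => h.
have -> : a = c by lia.
by have -> : b = d by lia.
Qed.

Lemma count_restr tau (b : nat * nat) :
  count_mem b tau = count_mem b.2 (restr tau b.1).
Proof.
rewrite /restr count_map count_filter; apply: eq_count => -[x y] /=.
by case: b => x' y'; rewrite xpair_eqE andbC.
Qed.

Lemma type_ext tau tau' : is_type tau -> is_type tau' ->
  (forall k, restr tau k = restr tau' k) -> tau = tau'.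
Proof.
move=> /andP[_ s] /andP[_ s'] e.
apply: (sorted_eq block_ge_trans block_ge_anti s s').
by apply/allP => b _; rewrite /= !count_restr e.
Qed.

Lemma restr_part tau k : is_type tau -> is_part (restr tau k).
Proof.
move=> ty; rewrite /is_part restr_pos//= /restr sorted_map.
have /andP[_ s] := ty.
apply: (@sub_in_sorted _ [pred b : nat * nat | b.1 == k] block_ge).
- by move=> [a b] [c d]; rewrite !inE /block_ge /= => /eqP -> /eqP ->; lia.
- by rewrite filter_all.
- by apply: sorted_filter s; exact: block_ge_trans.
Qed.

Lemma restr0 tau : is_type tau -> restr tau 0 = [::].
Proof.
move=> /andP[/allP bt _]; rewrite /restr (_ : [seq _ <- _ | _] = [::])//.
apply/eqP; rewrite -[_ == _]negbK -has_filter; apply/hasPn => b /bt /andP[b0 _].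
by rewrite -lt0n.
Qed.

Lemma restr_gt_maxdeg tau k : maxdeg tau < k -> restr tau k = [::].
Proof.
move=> mk; rewrite /restr (_ : [seq _ <- _ | _] = [::])//.
apply/eqP; rewrite -[_ == _]negbK -has_filter; apply/hasPn => b bt.
rewrite neq_ltn (leq_ltn_trans _ mk)//.
exact: (leq_bigmax_seq (F := fun b : nat * nat => b.1)).
Qed.

Lemma maxdeg_le tau K :
  (forall k, K < k -> restr tau k = [::]) -> maxdeg tau <= K.
Proof.
move=> h; rewrite /maxdeg; apply/bigmax_leqP_seq => b bt _.
rewrite leqNgt; apply/negP => /h e.
have : b.2 \in restr tau b.1 by apply: map_f; rewrite mem_filter eqxx.
by rewrite e.
Qed.

Fixpoint type_of (K : nat) (lam : nat -> seq nat) : seq (nat * nat) :=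
  if K is K'.+1 then [seq (K, p) | p <- lam K'] ++ type_of K' lam else [::].

Lemma restr_cat s t k : restr (s ++ t) k = restr s k ++ restr t k.
Proof. by rewrite /restr filter_cat map_cat. Qed.

Lemma restr_type_of K (lam : nat -> seq nat) k :
  restr (type_of K lam) k.+1 = if k < K then lam k else [::].
Proof.
elim: K => [//|K IH] /=; rewrite restr_cat IH /restr.
have [->|ne] := eqVneq k K.
  rewrite ltnSn ltnn cats0 (_ : [seq _ <- _ | _] = [seq (K.+1, p) | p <- lam
    K]).
    by rewrite -map_comp map_id.
  by apply/all_filterP/allP => _ /mapP[p _ ->]; rewrite /= eqxx.
rewrite (_ : [seq _ <- _ | _] = [::]);
  first by rewrite ltnS [k <= K]leq_eqVlt (negbTE ne).
apply/eqP; rewrite -[_ == _]negbK -has_filter;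
  apply/hasPn => _ /mapP[p _ ->] /=.
by rewrite eqSS eq_sym.
Qed.

Lemma type_of_le K (lam : nat -> seq nat) b : b \in type_of K lam -> b.1 <= K.
Proof.
elim: K => [//|K IH] /=; rewrite mem_cat => /orP[/mapP[p _ -> //]|/IH].
by move/leq_trans; apply.
Qed.

Lemma type_of_type K (lam : nat -> seq nat) :
  (forall k, k < K -> is_part (lam k)) -> is_type (type_of K lam).
Proof.
elim: K => [//|K IH] h /=.
have /andP[a s] := IH (fun k kK => h k (ltnW kK)).
have /andP[/allP a' s'] := h K (ltnSn K).
apply/andP; split.
  by rewrite all_cat a andbT; apply/allP => _ /mapP[p /a' p0 ->].
rewrite (sorted_pairwise block_ge_trans) pairwise_cat.
rewrite -!(sorted_pairwise block_ge_trans) s andbT.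
apply/andP; split.
  apply/allrelP => _ b /mapP[p _ ->] /type_of_le bK.
  by rewrite /block_ge /= ltnS bK.
rewrite sorted_map; apply: sub_sorted s' => x y.
by rewrite /block_ge /= eqxx => ->; rewrite orbT.
Qed.

(** The partition associated with adding [c k] ribbons in each degree [k.+1]. *)
Fixpoint counts_part (K : nat) (c : nat -> nat) : seq nat :=
  if K is K'.+1 then nseq (c K') K ++ counts_part K' c else [::].

Lemma counts_part_le K c x : x \in counts_part K c -> 0 < x <= K.
Proof.
elim: K => [//|K IH] /=; rewrite mem_cat => /orP[/nseqP[-> _]|/IH /andP[-> h]].
  by rewrite leqnn.
by rewrite ltnW.
Qed.

Lemma counts_part_part K c : is_part (counts_part K c).
Proof.
apply/andP; split; first by apply/allP => x /counts_part_le /andP[].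
have gt : transitive geq by move=> a b d /= ba db; exact: leq_trans db ba.
elim: K => [//|K IH] /=; rewrite (sorted_pairwise gt) pairwise_cat.
rewrite -!(sorted_pairwise gt) IH andbT; apply/andP; split.
  apply/allrelP => _ y /nseqP[-> _] /counts_part_le /andP[_ yK].
  exact: leqW.
rewrite (sorted_pairwise gt); elim: (c K) => //= n ->; rewrite andbT.
by apply/allP => y /nseqP[-> _] /=.
Qed.

Lemma sumn_counts_part K c : sumn (counts_part K c) = \sum_(k < K) k.+1 * c k.
Proof.
elim: K => [|K IH] /=; first by rewrite big_ord0.
by rewrite sumn_cat IH sumn_nseq big_ord_recr /= addnC.
Qed.

Lemma count_counts_part K c k :
  count_mem k.+1 (counts_part K c) = if k < K then c k else 0.
Proof.
elim: K => [//|K IH] /=; rewrite count_cat IH count_nseq /= eqSS eq_sym.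
have [->|ne] := eqVneq k K; first by rewrite ltnSn ltnn mul1n addn0.
by rewrite mul0n add0n ltnS [k <= K]leq_eqVlt (negbTE ne).
Qed.

Lemma part_by_counts K lam : {in lam, forall x, 0 < x <= K} ->
  size lam = \sum_(k < K) count_mem k.+1 lam /\
  sumn lam = \sum_(k < K) k.+1 * count_mem k.+1 lam.
Proof.
elim: lam => [|x lam IH] h.
  by split; rewrite big1// => k _; rewrite muln0.
have [|IH1 IH2] := IH; first by move=> y yl; apply: h; rewrite inE yl orbT.
have /andP[x0 xK] := h x (mem_head _ _).
have xK' : x.-1 < K by rewrite prednK.
have E (F : nat -> nat) : \sum_(k < K) F k * (x == k.+1) = F x.-1.
  rewrite (bigD1 (Ordinal xK'))//= prednK// eqxx muln1 big1 ?addn0// => k.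
  rewrite -val_eqE /= => ne; have -> : (x == k.+1) = false by move: ne; lia.
  by rewrite muln0.
have cE k : count_mem k (x :: lam) = (x == k) + count_mem k lam by [].
split.
  under eq_bigr do rewrite cE.
  rewrite big_split -IH1 -[LHS]add1n; congr (_ + _);
    rewrite -[LHS](E (fun=> 1)).
  by apply: eq_bigr => k _; rewrite mul1n.
under eq_bigr do rewrite cE mulnDr.
by rewrite big_split -IH2 (E succn) prednK.
Qed.

Lemma stensorE tau K : maxdeg tau <= K ->
  (stensor tau = \prod_(k < K) schur k.+1 (restr tau k.+1))%R.
Proof.
move=> mK; rewrite /stensor big_add1 /= big_mkord (big_ord_widen K (fun k =>
  schur k.+1 (restr tau k.+1)) mK).
rewrite big_mkcond; apply: eq_bigr => k _; case: ltnP => // mk.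
by rewrite restr_gt_maxdeg// schur_nil.
Qed.

End Types.

(** Equals [sgn_plus] at [u = 1], and is [sgn_minus] by conversion at [u = -1]. *)
Definition signed_step (u : rat) (b : nat * nat) (tau sigma : seq (nat * nat))
  : rat :=
  (u ^+ size (the_assoc b tau sigma) * sgn_plus b tau sigma)%R.

Lemma rows_inj N : injective (@rows N).
Proof.
move=> S S' e; apply/setP => j.
by rewrite -mem_enum -[RHS]mem_enum -!(mem_map val_inj) -/(rows S) e.
Qed.

Lemma size_rows N (S : {set 'I_N}) : size (rows S) = #|S|.
Proof. by rewrite /rows size_map cardE. Qed.

Lemma rows_surj N qs : sorted ltn qs -> (forall q, q \in qs -> q < N) ->
  exists S : {set 'I_N}, rows S = qs.
Proof.
move=> srt qN; exists [set j : 'I_N | (j : nat) \in qs].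
apply: (irr_sorted_eq ltn_trans ltnn (rows_sorted _) srt) => q.
apply/mapP/idP => [[j + ->]|qqs]; first by rewrite mem_enum inE.
by exists (Ordinal (qN q qqs)); rewrite // mem_enum inE.
Qed.

Lemma scale_sign (b : bool) n (g : series) :
  (b%:R * (-1) ^+ n * g = (b%:R * (-1) ^+ n : rat) *: g)%R.
Proof.
case: b; last by rewrite !mul0r scale0r.
rewrite !mul1r -signr_odd -[in RHS]signr_odd.
by case: odd; rewrite ?expr1 ?mulN1r ?scaleN1r // expr0 mul1r scale1r.
Qed.

(** * Multiplication by a single factor *)

Section OneStep.
Variables (sigma : seq (nat * nat)) (d r K N : nat) (u : rat).
Hypotheses (sigma_type : is_type sigma) (r_gt0 : 0 < r).
Hypotheses (dK : d <= K) (sigmaK : maxdeg sigma <= K).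
(** A component gains at most [d] ribbons of [r] boxes, so [N] rows hold every shape that can
    arise. *)
Hypothesis sigmaN : forall k, #|` dg (restr sigma k)| + d * r <= N.

Let f (k : nat) : nat -> nat := nth 0 (restr sigma k.+1).
Let fdec k : decreasing (f k) := part_decreasing (restr_part k.+1 sigma_type).

Local Notation families := {ffun 'I_K -> {set 'I_N}}.
Implicit Types S : families.

Definition family_rows S (k : nat) : seq nat :=
  if (insub k : option 'I_K) is Some k' then rows (S k') else [::].

Lemma family_rowsE S (k : 'I_K) : family_rows S k = rows (S k).
Proof. by rewrite /family_rows valK. Qed.

Definition family_movable S : bool :=
  [forall k : 'I_K, movable r (f k) (family_rows S k)].

Definition family_type S : seq (nat * nat) :=
  type_of K (fun k => strip N (moves r (f k) (family_rows S k))).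

Definition family_sign S : rat :=
  (\prod_(k < K) (-1) ^+ jumps r (f k) (family_rows S k))%R.

Let size_sigma k : size (restr sigma k) <= N.
Proof.
apply: leq_trans (sigmaN k); apply: leq_trans (leq_addr _ _).
exact/size_dg/restr_pos.
Qed.

Section Good.
Variable S : families.
Hypothesis goodS : family_movable S.

Let mv k : movable r (f k) (family_rows S k).
Proof.
rewrite /family_rows; case: insubP => //= k' _ <-.
by rewrite -family_rowsE; move/forallP: goodS; exact.
Qed.

Let rows_lt k q : q \in family_rows S k -> q < N.
Proof.
rewrite /family_rows; case: insubP => //= k' _ _ /mapP[j _ ->]; exact: ltn_ord.
Qed.

Let rows_srt k : sorted ltn (family_rows S k).
Proof. by rewrite /family_rows; case: insubP => //= k' _ _;
  exact: rows_sorted. Qed.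

Let moves_part k : is_part (strip N (moves r (f k) (family_rows S k))) /\
  nth 0 (strip N (moves r (f k) (family_rows S k))) =1
    moves r (f k) (family_rows S k).
Proof.
apply: stripP; first by apply: moves_decreasing.
move=> i Ni; rewrite (moves_gt r_gt0) => [|q /rows_lt qN];
  last exact: leq_trans qN Ni.
by rewrite /f nth_default//; exact: leq_trans Ni.
Qed.

Lemma family_type_type : is_type (family_type S).
Proof. by apply: type_of_type => k _; have [] := moves_part k. Qed.

Lemma nth_restr_family_type k : nth 0 (restr (family_type S) k.+1) =1
  moves r (f k) (family_rows S k).
Proof.
move=> i; rewrite restr_type_of; case: ltnP => kK;
  first by have [_ ->] := moves_part k.
rewrite /family_rows insubN -?leqNgt//= /f restr_gt_maxdeg//.
exact: leq_ltn_trans sigmaK _.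
Qed.

Lemma maxdeg_family_type : maxdeg (family_type S) <= K.
Proof.
apply: maxdeg_le => -[//|k] kK; rewrite restr_type_of.
by case: ltnP => //; lia.
Qed.

Lemma family_polyribbon k :
  dual_polyribbon r (size (family_rows S k)) (restr (family_type S) k.+1)
    (restr sigma k.+1).
Proof.
apply: (moves_dual_chain r_gt0) => //; first exact: restr_part.
  exact/restr_part/family_type_type.
  exact: mv.
exact: nth_restr_family_type.
Qed.

Lemma sgn_dual_family_type n k :
  dual_polyribbon r n (restr (family_type S) k.+1) (restr sigma k.+1) ->
  n = size (family_rows S k) /\
  (sgn_dual r (restr (family_type S) k.+1) (restr sigma k.+1) =
  (-1) ^+ jumps r (f k) (family_rows S k))%R.
Proof.
move=> dp; apply: (sgn_dualE r_gt0 dp); [exact: rows_srt|exact: mv|].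
exact: nth_restr_family_type.
Qed.

Lemma family_assoc : family_degree S = d ->
  is_assoc (d, r) (family_type S) sigma
    (counts_part K (fun k => size (family_rows S k))).
Proof.
move=> dS; split; first exact: counts_part_part.
  rewrite sumn_counts_part -dS; apply: eq_bigr => k _.
  by rewrite family_rowsE size_rows.
move=> [//|k] _; rewrite count_counts_part.
have := family_polyribbon k; case: ltnP => // kK.
by rewrite /family_rows insubN// -leqNgt.
Qed.

Lemma signed_step_family_type : family_degree S = d ->
  signed_step u (d, r) (family_type S) sigma =
  (u ^+ family_size S * family_sign S)%R.
Proof.
move=> dS; rewrite /signed_step; congr (_ * _)%R.
  have [/andP[/allP pos _] sm dp] :
      is_assoc (d, r) (family_type S) sigma (the_assoc (d, r) (family_type S)
        sigma).
    by apply: xgetPex; eexists; exact: family_assoc.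
  have [|-> _] := @part_by_counts K (the_assoc (d, r) (family_type S) sigma).
    move=> x xl; rewrite (pos x xl) /= (leq_trans _ dK)//.
    by rewrite -[d]/((d, r).1) -sm part_mem_sumn.
  congr (u ^+ _)%R; apply: eq_bigr => k _.
  have [-> _] := sgn_dual_family_type (dp k.+1 isT).
  by rewrite family_rowsE size_rows.
rewrite /sgn_plus /family_sign big_add1 /= big_mkord.
rewrite (big_ord_widen K (fun k => sgn_dual r (restr (family_type S) k.+1)
  (restr sigma k.+1)) maxdeg_family_type).
rewrite big_mkcond; apply: eq_bigr => k _.
have [_ <-] := sgn_dual_family_type (family_polyribbon k).
case: ltnP => // mk.
(* The sign of this degree is absent from the product. The component of the new type is empty there,
   hence so is that of [sigma], and the sign is 1. *)
have := family_polyribbon k; rewrite (restr_gt_maxdeg (tau := family_type S))//.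
move=> dp; have [_ part_s] := dual_polyribbon_part dp.
have sk : restr sigma k.+1 = [::].
  have [qs [_ _ mvq e _]] := dual_polyribbon_moves r_gt0 dp.
  apply: part_ext => // i; apply/eqP; rewrite nth_nil -leqn0.
  by have := moves_ge r_gt0 i (fdec k) mvq; rewrite -e nth_nil.
have dp0 : dual_polyribbon r 0 [::] [::] by exists [:: [::]]; split.
by have [_ e] := @sgn_dualE r r_gt0 _ _ _ [::] dp0 isT isT (fun=> erefl);
  rewrite sk e.
Qed.

Lemma family_type_agree :
  agree N (\prod_(k < K) schur_poly (fun j => variable (k : nat, j)) N
                           (moves r (f k) (family_rows S k)))%R
          (stensor (family_type S)).
Proof.
rewrite (stensorE maxdeg_family_type); apply: agree_prod => k m mN.
have e := funext (nth_restr_family_type k); rewrite -e.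
apply/esym/schur_part_agree => //; first exact/restr_part/family_type_type.
rewrite restr_type_of ltn_ord /strip size_filter (leq_trans (count_size _ _))//.
by rewrite size_mkseq.
Qed.

End Good.

Lemma family_type_inj S S' : family_movable S -> family_movable S' ->
  family_type S = family_type S' -> S = S'.
Proof.
move=> gS gS' e; apply/ffunP => k; apply: rows_inj; rewrite -!family_rowsE.
move/forallP/(_ k): (gS) => mv; move/forallP/(_ k): (gS') => mv'.
apply: (moves_inj r_gt0 (fdec k)) => //; rewrite ?family_rowsE ?rows_sorted//.
by move=> i; rewrite -!family_rowsE -!nth_restr_family_type// e.
Qed.

(** [sigmaN] puts the moved rows below [N], so they form a subset of ['I_N] in each degree; no part
    of [lam] exceeds [K], so higher degrees are unchanged. *)
Lemma family_type_surj tau : is_type tau ->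
  dual_tensor_polyribbon (d, r) tau sigma ->
  exists S, [/\ family_movable S, family_degree S = d & tau = family_type S].
Proof.
move=> ty [lam [part_lam sm dp]].
have lamK : {in lam, forall x, 0 < x <= K}.
  move=> x xl; have /andP[/allP/(_ x xl) -> _] := part_lam.
  by rewrite (leq_trans _ dK)// -[d]/((d, r).1) -sm part_mem_sumn.
have lam_size : size lam <= d.
  by rewrite -[d]/((d, r).1) -sm part_size_sumn//; case/andP: part_lam.
have ex (k : 'I_K) : exists A : {set 'I_N},
    [/\ #|A| = count_mem k.+1 lam, movable r (f k) (rows A) &
        nth 0 (restr tau k.+1) =1 moves r (f k) (rows A)].
  have [qs [sz srt mv e lt]] := dual_polyribbon_moves r_gt0 (dp k.+1 isT).
  have [|A Aqs] := @rows_surj N qs srt.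
    move=> q /lt /leq_trans; apply; apply: leq_trans (sigmaN k.+1).
    by rewrite leq_add2l leq_mul2r (leq_trans (count_size _ _) lam_size) orbT.
  by exists A; rewrite -size_rows Aqs sz.
have [S SP] := fin_all_exists ex.
have SP' k : nth 0 (restr tau (k : 'I_K).+1) =1 moves r (f k) (family_rows
  (finfun S) k).
  by have [_ _ h] := SP k; rewrite family_rowsE ffunE.
have good : family_movable (finfun S).
  by apply/forallP => k; rewrite family_rowsE ffunE; have [] := SP k.
exists (finfun S); split=> //.
  have [_ sE] := part_by_counts lamK.
  rewrite -[RHS]/((d, r).1) -sm sE; apply: eq_bigr => k _.
  by rewrite ffunE; have [-> _ _] := SP k.
apply: type_ext => //; first exact: family_type_type.
move=> [|k]; first by rewrite !restr0//; exact: family_type_type.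
apply: part_ext; [exact: restr_part|exact/restr_part/family_type_type|].
move=> i; rewrite nth_restr_family_type//.
have [kK|Kk] := ltnP k K; first exact: (SP' (Ordinal kK)).
have [qs [sz _ _ -> _]] := dual_polyribbon_moves r_gt0 (dp k.+1 isT).
have -> : qs = [::].
  apply: size0nil; rewrite sz; apply/count_memPn/negP => /lamK /andP[_].
  by rewrite ltnNge Kk.
by rewrite /family_rows insubN// -leqNgt.
Qed.

Lemma step_agree :
  agree N (stensor sigma * subst_pow r (Esigned u d))%R
    (\sum_(S : families | (family_degree S == d) && family_movable S)
       (u ^+ family_size S * family_sign S) *: stensor (family_type S))%R.
Proof.
move=> m mN.
pose c (n : {ffun 'I_K -> nat}) : bool := \sum_(k < K) k.+1 * n k == d.
have cE S : c [ffun k => #|S k|] = (family_degree S == d).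
  by rewrite /c /family_degree; congr (_ == _); apply: eq_bigr => k _;
    rewrite ffunE.
pose X (k : 'I_K) (j : nat) := variable (k : nat, j).
(* [F] and [G] are the two sides of the Pieri rule in degree [k.+1], equal only after summation over
   sets of one size. In [G], impossible moves carry the coefficient 0. *)
pose F (k : 'I_K) (A : {set 'I_N}) : series :=
  (schur_poly (X k) N (f k) * (u ^+ #|A| *: \prod_(j in A) X k j ^+ r))%R.
pose G (k : 'I_K) (A : {set 'I_N}) : series :=
  ((u ^+ #|A| * ((movable r (f k) (rows A))%:R * (-1) ^+ jumps r (f k) (rows
    A)))
     *: schur_poly (X k) N (moves r (f k) (rows A)))%R.
have FG k n : (\sum_(A : {set 'I_N} | #|A| == n) F k A =
    \sum_(A : {set 'I_N} | #|A| == n) G k A)%R.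
  transitivity (u ^+ n *: (schur_poly (X k) N (f k) *
      \sum_(A : {set 'I_N} | #|A| == n) \prod_(j in A) X k j ^+ r))%R.
    rewrite mulr_sumr scaler_sumr; apply: eq_bigr => A /eqP <-.
    by rewrite /F scalerAr.
  rewrite (schur_poly_pieri r_gt0 _ (fdec k)); last exact: vandermonde_lreg.
  rewrite scaler_sumr; apply: eq_bigr => A /eqP <-.
  by rewrite scale_sign scalerA.
pose P : series := (\prod_(k < K) schur_poly (X k) N (f k))%R.
transitivity ((\sum_(S : families | c [ffun k => #|S k|]) \prod_(k < K) F k (S
  k))%R m).
  transitivity ((P * (\sum_(S : families | family_degree S == d)
      u ^+ family_size S *:
        \prod_(k < K) \prod_(j in S k) X k j ^+ r))%R m).
    apply: (agreeM (N := N)) => //; last exact: (Esigned_pow_agree u dK r_gt0).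
    rewrite (stensorE sigmaK); apply: agree_prod => k.
    by apply: schur_part_agree; [exact: restr_part|].
  congr (_ m); rewrite mulr_sumr; apply: eq_big => [S|S _]; first by rewrite cE.
  by rewrite /F big_split /= scaler_prod prodrXr.
rewrite (sum_families_by_size c FG) sum_seriesE [RHS]sum_seriesE.
rewrite big_mkcondr /=; apply: eq_big => [S|S _]; first by rewrite cE.
have GE : (\prod_(k < K) G k (S k) =
    (u ^+ family_size S * family_sign S * (family_movable S)%:R) *:
    \prod_(k < K) schur_poly (X k) N (moves r (f k) (family_rows S k)))%R.
  rewrite /G scaler_prod big_split big_split /= prodrXr -/(family_size S).
  rewrite -mulrA [(family_sign S * _)%R]mulrC; congr (_ * (_ * _) *: _)%R.
  - rewrite /family_movable; case: forallP => [mv|nmv].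
      by apply: big1 => k _; have := mv k; rewrite family_rowsE => ->.
    have /existsNP[k] := nmv; rewrite family_rowsE => /negP/negbTE mk.
    by rewrite (bigD1 k)//= mk mul0r.
  - by apply: eq_bigr => k _; rewrite family_rowsE.
  - by apply: eq_bigr => k _; rewrite family_rowsE.
rewrite GE; case: ifP => good; last by rewrite mulr0 scale0r.
rewrite mulr1; congr (_ * _)%R.
exact: family_type_agree.
Qed.

End OneStep.

(** * Tableaux *)

Section Expansion.
Variable u : rat.
Implicit Types (sigma tau : seq (nat * nat)) (delta : seq (nat * nat)).

Definition successors (b : nat * nat) sigma : {fset seq (nat * nat)} :=
  fset_set [set tau | is_type tau /\ dual_tensor_polyribbon b tau
    sigma]%classic.

Lemma mem_successors b sigma tau : is_type sigma ->
  tau \in successors b sigma <-> is_type tau /\ dual_tensor_polyribbon b tau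
    sigma.
Proof.
move=> ty; rewrite in_fset_set; first by rewrite inE.
apply: sub_finite_set (finite_shapes [:: b] ty) => t [tt dt].
exists [:: sigma; t]; split=> //=; first by rewrite ty tt.
by case.
Qed.

(** The truncation depends on the monomial [m], but the final sum over successors does not, so
    equality holds at every coefficient. *)
Lemma step_expansion b sigma : is_type sigma -> is_block b ->
  (stensor sigma * subst_pow b.2 (Esigned u b.1) =
   \sum_(tau <- successors b sigma) signed_step u b tau sigma *: stensor tau)%R.
Proof.
case: b => d r ty /andP[/= _ r0]; apply/funext => m.
pose K := d + maxdeg sigma.
(* Large enough for the variables of [m] and, as [sN] asks, for the boxes of any component after the
   step. *)
pose N := \max_(v <- m) v.2.+1 +
  \sum_(k < (maxdeg sigma).+1) #|` dg (restr sigma k)| + d * r.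
have dK : d <= K by exact: leq_addr.
have sK : maxdeg sigma <= K by exact: leq_addl.
have sN k : #|` dg (restr sigma k)| + d * r <= N.
  rewrite /N leq_add2r; have [kM|Mk] := ltnP k (maxdeg sigma).+1.
    by apply: leq_trans (leq_addl _ _);
      rewrite (bigD1 (Ordinal kM)) //= leq_addr.
  rewrite restr_gt_maxdeg// (_ : dg [::] = fset0) ?cardfs0//.
  by apply/fsetP => -[i j]; rewrite mem_dg inE; case: i.
have mN : bounded_vars N m.
  move=> v vm; rewrite /N -addnA; apply: leq_trans (leq_addr _ _).
  exact: (leq_bigmax_seq (F := fun v : nat * nat => v.2.+1)).
rewrite (@step_agree sigma d r K N u ty r0 dK sK sN m mN) !sum_seriesE.
transitivity (\sum_(S : {ffun 'I_K -> {set 'I_N}} |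
    (family_degree S == d) && family_movable sigma r S)
   (signed_step u (d, r) (family_type sigma r S) sigma
      *: stensor (family_type sigma r S)) m)%R.
  apply: eq_bigr => S /andP[/eqP dS gS].
  by rewrite (signed_step_family_type u ty r0 dK sK sN gS dS).
rewrite -big_filter -(big_map (@family_type sigma r K N) xpredT
  (fun tau => (signed_step u (d, r) tau sigma *: stensor tau)%R m)).
(* Movable families of degree [d] correspond bijectively to the successors of [sigma]. *)
apply/perm_big/uniq_perm; last move=> tau.
- rewrite map_inj_in_uniq ?filter_uniq ?index_enum_uniq// => S S'.
  rewrite !mem_filter => /andP[/andP[_ gS] _] /andP[/andP[_ gS'] _].
  exact: (family_type_inj ty r0 sK sN gS gS').
- exact: fset_uniq.
apply/mapP/idP => [[S]|/mem_successors-/(_ ty)[tt dt]].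
  rewrite mem_filter => /andP[/andP[/eqP dS gS] _] ->.
  apply/mem_successors => //; split;
    first exact: (family_type_type ty r0 sN gS).
  by eexists; exact: (family_assoc ty r0 sK sN gS dS).
have [S [gS dS ->]] := family_type_surj ty r0 dK sK sN tt dt.
by exists S => //; rewrite mem_filter dS eqxx gS mem_index_enum.
Qed.

Fixpoint tableaux sigma delta : seq (seq (seq (nat * nat))) :=
  if delta is b :: delta' then
    [seq sigma :: T | tau <- successors b sigma, T <- tableaux tau delta']
  else [:: [:: sigma]].

Definition tableau_sign delta (T : seq (seq (nat * nat))) : rat :=
  (\prod_(i < size delta)
    signed_step u (nth (0%N, 0%N) delta i) (nth [::] T i.+1) (nth [::] T i))%R.

Lemma tableaux_head sigma delta T : T \in tableaux sigma delta ->
  nth [::] T 0 = sigma.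
Proof.
case: delta => [|b delta] /=; first by rewrite inE => /eqP ->.
by case/allpairsPdep => tau [T' [_ _ ->]].
Qed.

Lemma mem_tableaux sigma delta T tau : is_type sigma ->
  TPRT tau sigma delta T <->
  T \in tableaux sigma delta /\ nth [::] T (size delta) = tau.
Proof.
elim: delta sigma T => [|b delta IH] sigma T ty /=.
  rewrite inE; split=> [[sT T0 T1 _ _]|[/eqP -> <-]].
    split=> //; apply/eqP; case: T sT T0 {T1} => [//|x [|]] //= _ ->.
    by [].
  by split=> //=; rewrite ty.
split=> [[sT T0 Tn aT step]|[/allpairsPdep[tau1 [T' [/mem_successors-/(_
  ty)[ty1 dt1] T'in ->]]] /= Tn]].
  case: T sT T0 Tn aT step => [//|x T] /= [sT] -> Tn /andP[_ aT] step.
  split=> //; apply/allpairsPdep; exists (nth [::] T 0), T.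
  have ty1 : is_type (nth [::] T 0) by apply: (allP aT); rewrite mem_nth ?sT.
  split=> //; first by apply/mem_successors => //; split=> //; exact: (step 0).
  suff /(IH _ _ ty1)[] : TPRT tau (nth [::] T 0) delta T by [].
  by split=> // i hi; exact: (step i.+1).
have /(IH _ _ ty1)[sT' T'0 T'n aT' step'] : T' \in tableaux tau1 delta /\
  nth [::] T' (size delta) = tau by [].
split=> //=; [by rewrite sT'|by rewrite ty|].
by case=> [|i] hi /=; [rewrite T'0|exact: step'].
Qed.

Lemma tableaux_uniq sigma delta : uniq (tableaux sigma delta).
Proof.
elim: delta sigma => [//|b delta IH] sigma /=.
apply: allpairs_uniq_dep; [exact: fset_uniq|by move=> *; exact: IH|].
move=> _ _ /allpairsPdep[t [T [_ tT ->]]] /allpairsPdep[t' [T' [_ tT' ->]]] /=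
  [e].
by move: tT'; rewrite -e => /tableaux_head <-; rewrite (tableaux_head tT).
Qed.

Lemma tableaux_expansion sigma delta : is_type sigma -> all is_block delta ->
  (stensor sigma * \prod_(b <- delta) subst_pow b.2 (Esigned u b.1) =
   \sum_(T <- tableaux sigma delta)
     tableau_sign delta T *: stensor (nth [::] T (size delta)))%R.
Proof.
elim: delta sigma => [|b delta IH] sigma ty /=.
  by rewrite big_nil mulr1 big_seq1 /tableau_sign big_ord0 scale1r.
move=> /andP[bb bd]; rewrite big_cons mulrA step_expansion// mulr_suml.
rewrite big_allpairs_dep /=;
  apply: eq_big_seq => tau /mem_successors-/(_ ty)[tt _].
rewrite -scalerAl IH// scaler_sumr; apply: eq_big_seq => T Tin.
by rewrite scalerA /tableau_sign big_ord_recl /= (tableaux_head Tin).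
Qed.

Local Open Scope classical_set_scope.

(** The sum over tableaux is regrouped by final type. *)
Lemma TPRT_expansion sigma delta : is_type sigma -> all is_block delta ->
  (stensor sigma * \prod_(b <- delta) subst_pow b.2 (Esigned u b.1) =
   \sum_(tau \in [set tau | is_type tau])
      (\sum_(T \in TPRT tau sigma delta) tableau_sign delta T) *: stensor
        tau)%R.
Proof.
move=> ty bd; rewrite tableaux_expansion//.
pose L := tableaux sigma delta;
  pose end_ T := nth [::] T (size delta) : seq (nat * nat).
have inner tau : (\sum_(T \in TPRT tau sigma delta) tableau_sign delta T =
    \sum_(T <- L | end_ T == tau) tableau_sign delta T)%R.
  rewrite (_ : TPRT tau sigma delta = [set` [seq T <- L | end_ T == tau]]).
    by rewrite -fsbig_seq ?big_filter// filter_uniq// tableaux_uniq.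
  apply/seteqP; split=> T /=; rewrite mem_filter.
    by move=> /(mem_tableaux _ _ _ ty)[-> e]; rewrite /end_ e eqxx.
  by move=> /andP[/eqP e TL]; apply/mem_tableaux.
have end_type tau : tau \in undup [seq end_ T | T <- L] -> is_type tau.
  rewrite mem_undup => /mapP[T TL ->].
  have [sT _ _ /allP aT _] : TPRT (end_ T) sigma delta T by apply/mem_tableaux.
  by apply/aT/mem_nth; rewrite sT.
(* Types that end no tableau have coefficient 0, so the outer sum reduces to the finite list of
   ends. *)
rewrite (@fsbigE _ _ _ _ _ (undup [seq end_ T | T <- L])) ?undup_uniq//;
  last first.
  move=> tau _; rewrite mem_undup => tauL; rewrite inner big1_seq ?scale0r//.
  move=> T /andP[/eqP e TL]; case/negP: tauL; rewrite -e; exact: map_f.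
under [RHS]eq_bigr do rewrite inner scaler_suml.
rewrite (exchange_big_dep xpredT) //= big_seq [RHS]big_seq.
apply: eq_bigr => T TL; rewrite -big_filter.
rewrite (@eq_in_filter _ _ (pred1 (end_ T))) => [|tau /end_type tt]; last first.
  by rewrite mem_set//= eq_sym.
by rewrite filter_pred1_uniq ?undup_uniq ?mem_undup ?map_f// big_seq1.
Qed.

End Expansion.

Local Open Scope classical_set_scope.
Local Open Scope ring_scope.

Theorem theorem32 (sigma delta : seq (nat * nat))
    (sigma_type : is_type sigma) (delta_blocks : all is_block delta) :
  stensor sigma * Eplus_seq delta =
    \sum_(tau \in [set tau | is_type tau])
      (\sum_(T \in TPRT tau sigma delta) tab_sgn_plus delta T) *: stensor tau
  /\
  stensor sigma * Eminus_seq delta =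
    \sum_(tau \in [set tau | is_type tau])
      (\sum_(T \in TPRT tau sigma delta) tab_sgn_minus delta T) *: stensor tau.
Proof.
have EplusE d : Eplus d = Esigned 1 d.
  by apply/funext => m; rewrite /Eplus /Esigned expr1n; case: ifP.
have sgnE : tab_sgn_plus = tableau_sign 1.
  apply/funext => dl; apply/funext => T; apply: eq_bigr => i _.
  by rewrite /signed_step expr1n mul1r.
(* At [u = -1] the series and the signs agree by conversion; only [u = 1] needs the rewriting of
   powers of 1. *)
split; last exact: (TPRT_expansion (-1) sigma_type delta_blocks).
rewrite sgnE -(TPRT_expansion 1 sigma_type delta_blocks) /Eplus_seq.
by congr (_ * _); apply: eq_bigr => b _; rewrite EplusE.
Qed.
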